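(* Let $\mathcal{U}$ be a subcategory of $\mathcal{G}$ and consider an object $X\in\mathcal{A}\mathcal{U}$. (a) $X$ is finitely generated if and only if $X$ has finite type and there exists $N\in\mathbb{N}$ such that the canonical map $\tau_n(X)\to X$ is an epimorphism for all $n\ge N$. (b) $X$ is finitely presented if and only if $X$ has finite type and there exists $N\in\mathbb{N}$ such that the canonical map $\tau_n(X)\to X$ is an isomorphism for all $n\ge N$.
   Context: Fix a field $k$ of characteristic zero. $\mathcal{G}$ is the category whose objects are finite groups and whose morphisms are conjugacy classes of surjective group homomorphisms. A subcategory of $\mathcal{G}$ is always full and replete. For $\mathcal{U}\le\mathcal{G}$, $\mathcal{A}\mathcal{U}=[\mathcal{U}^{\mathrm{op}},\mathrm{Vect}_k]$. $X\in\mathcal{A}\mathcal{U}$ has finite type if $\dim X(G)<\infty$ for all $G\in\mathcal{U}$. An object is finitely projective if it is the direct sum of a finite family of indecomposable projectives. $X$ is finitely generated if there is an epimorphism $P_0\to X$ with $P_0$ finitely projective (equivalently, with $P_0=\bigoplus_{i=1}^ne_{G_i}$ where $e_G(T)=k[\mathcal{U}(T,G)]$); $X$ is finitely presented if there is a right exact sequence $P_1\to P_0\to X\to 0$ with $P_0,P_1$ finitely projective. Put $\mathcal{U}_{\le n}=\{G\in\mathcal{U}\mid|G|\le n\}$. Let $i_{\le n}^*\colon\mathcal{A}\mathcal{U}\to\mathcal{A}\mathcal{U}_{\le n}$ be restriction along the inclusion, with left adjoint $i_!^{\le n}$ (left Kan extension). Then $\tau_n(X)=i_!^{\le n}i_{\le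 n}^*(X)$, and the canonical map $\tau_n(X)\to X$ is the counit of the adjunction. *)

(* Defs.v *)
From HB Require Import structures.
From mathcomp Require Import all_boot all_order all_fingroup all_algebra.
From mathcomp Require Import generic_quotient boolp.

Set Implicit Arguments.
Unset Strict Implicit.
Unset Printing Implicit Defensive.

Import GRing.Theory.
Local Open Scope ring_scope.
Local Open Scope quotient_scope.

Record category := Category {
  ob :> Type;
  hom : ob -> ob -> Type;
  idm : forall x, hom x x;
  hcomp : forall x y z, hom y z -> hom x y -> hom x z;
  compidl : forall x y (f : hom x y), hcomp (idm y) f = f;
  compidr : forall x y (f : hom x y), hcomp f (idm x) = f;
  compA : forall x y z t (h : hom z t) (g : hom y z) (f : hom x y),
    hcomp h (hcomp g f) = hcomp (hcomp h g) f }.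

Arguments idm {c} x.

Definition isomorphic (C : category) (x y : C) :=
  exists (f : hom x y) (g : hom y x), hcomp g f = idm x /\ hcomp f g = idm y.

Record functor (C D : category) := Functor {
  fob :> C -> D;
  fmap : forall x y, hom x y -> hom (fob x) (fob y);
  fmap_id : forall x, fmap (idm x) = idm (fob x);
  fmap_comp : forall x y z (g : hom y z) (f : hom x y),
    fmap (hcomp g f) = hcomp (fmap g) (fmap f) }.

Definition replete (C : category) (U : C -> Prop) :=
  forall x y : C, isomorphic x y -> U x -> U y.

Section FullSubcategory.
Variables (C : category) (U : C -> Prop).

Definition fullsub : category :=
  @Category {x : C | U x} (fun x y => hom (sval x) (sval y))
    (fun x => idm (sval x)) (fun x y z g f => hcomp g f)
    (fun x y f => compidl f) (fun x y f => compidr f)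
    (fun x y z t h g f => compA h g f).

Definition fullsub_incl : functor fullsub C :=
  @Functor fullsub C (fun x => sval x) (fun x y f => f)
    (fun x => erefl) (fun x y z g f => erefl).
End FullSubcategory.

(* A morphism from G to H is literally a conjugacy class of surjective
   homomorphisms, as a set of functions from G to H. *)
Section FiniteGroups.
Local Open Scope group_scope.

Definition surj_morph (G H : finGroupType) (f : {ffun G -> H}) : bool :=
  morphic [set: G] f && (f @: [set: G] == [set: H]).

Definition conj_class (G H : finGroupType) (f : {ffun G -> H}) :
    {set {ffun G -> H}} :=
  [set [ffun x => f x ^ h] | h in [set: H]].

Definition is_gmor (G H : finGroupType) (A : {set {ffun G -> H}}) : bool :=
  [exists f, surj_morph f && (A == conj_class f)].

Definition gmor (G H : finGroupType) := {A : {set {ffun G -> H}} | is_gmor A}.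

Lemma surj_morphP (G H : finGroupType) (f : {ffun G -> H}) :
  reflect ({morph f : x y / x * y} /\ forall y, exists x, f x = y)
          (surj_morph f).
Proof.
apply: (iffP andP) => -[fM fS]; split.
- by move=> x y; apply: (morphicP fM); rewrite inE.
- by move=> y; have := in_setT y; rewrite -(eqP fS) => /imsetP[x _ ->]; exists x.
- by apply/morphicP => x y _ _; apply: fM.
- apply/eqP/setP => y; rewrite inE; have [x <-] := fS y.
  by rewrite imset_f ?inE.
Qed.

Definition gid_set (G : finGroupType) := conj_class [ffun x : G => x].

Lemma surj_morph_id (G : finGroupType) : surj_morph [ffun x : G => x].
Proof.
apply/surj_morphP; split=> [x y|y]; first by rewrite !ffunE.
by exists y; rewrite ffunE.
Qed.

Lemma gid_subproof (G : finGroupType) : is_gmor (gid_set G).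
Proof. by apply/existsP; exists [ffun x : G => x]; rewrite eqxx surj_morph_id. Qed.

Definition gcomp_set (G H K : finGroupType)
    (B : {set {ffun H -> K}}) (A : {set {ffun G -> H}}) : {set {ffun G -> K}} :=
  [set [ffun x => (g : {ffun H -> K}) ((f : {ffun G -> H}) x)] | g in B, f in A].

Lemma gcomp_class (G H K : finGroupType) (g : {ffun H -> K}) (f : {ffun G -> H}) :
  surj_morph g -> gcomp_set (conj_class g) (conj_class f) =
    conj_class [ffun x => g (f x)].
Proof.
move=> /surj_morphP[gM gS].
have g1 : g 1 = 1 by apply: (mulgI (g 1)); rewrite -gM !mulg1.
have gV x : g x^-1 = (g x)^-1.
  by apply: (mulgI (g x)); rewrite -gM !mulgV.
apply/setP=> u; apply/imset2P/imsetP.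
  move=> [_ _ /imsetP[a _ ->] /imsetP[b _ ->] ->].
  exists (g b * a); first by rewrite inE.
  by apply/ffunP=> x; rewrite !ffunE conjgM /conjg !(gM, gV) !mulgA.
move=> [a _ ->]; exists [ffun x => g x ^ a] [ffun x => f x ^ 1].
- by apply/imsetP; exists a; rewrite ?inE.
- by apply/imsetP; exists 1; rewrite ?inE.
- by apply/ffunP=> x; rewrite !ffunE conjg1.
Qed.

Lemma gcomp_subproof (G H K : finGroupType) (B : gmor H K) (A : gmor G H) :
  is_gmor (gcomp_set (val B) (val A)).
Proof.
have /existsP[f /andP[sf /eqP->]] := valP A.
have /existsP[g /andP[sg /eqP->]] := valP B.
rewrite gcomp_class //; apply/existsP; exists [ffun x => g (f x)].
rewrite eqxx andbT.
move: sf sg => /surj_morphP[fM fS] /surj_morphP[gM gS].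
apply/surj_morphP; split=> [x y|y]; first by rewrite !ffunE fM gM.
by have [z <-] := gS y; have [x <-] := fS z; exists x; rewrite ffunE.
Qed.

Definition gid (G : finGroupType) : gmor G G := Sub (gid_set G) (gid_subproof G).

Definition gcomp (G H K : finGroupType) (B : gmor H K) (A : gmor G H) :
  gmor G K := Sub (gcomp_set (val B) (val A)) (gcomp_subproof B A).

Lemma gcompidl (G H : finGroupType) (A : gmor G H) : gcomp (gid H) A = A.
Proof.
apply: val_inj; have /existsP[f /andP[_ /eqP Af]] := valP A.
rewrite /= Af gcomp_class ?surj_morph_id //.
by congr conj_class; apply/ffunP=> x; rewrite !ffunE.
Qed.

Lemma gcompidr (G H : finGroupType) (A : gmor G H) : gcomp A (gid G) = A.
Proof.
apply: val_inj; have /existsP[f /andP[sf /eqP Af]] := valP A.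
rewrite /= Af gcomp_class //.
by congr conj_class; apply/ffunP=> x; rewrite !ffunE.
Qed.

Lemma gcompA (G H K L : finGroupType)
    (E : gmor K L) (B : gmor H K) (A : gmor G H) :
  gcomp E (gcomp B A) = gcomp (gcomp E B) A.
Proof.
apply: val_inj => /=; apply/setP=> u; apply/imset2P/imset2P.
  move=> [e _ eE /imset2P[b a bB aA ->] ->].
  exists [ffun x => e (b x)] a => //; first by apply/imset2P; exists e b.
  by apply/ffunP=> x; rewrite !ffunE.
move=> [_ a /imset2P[e b eE bB ->] aA ->].
exists e [ffun x => b (a x)] => //; first by apply/imset2P; exists b a.
by apply/ffunP=> x; rewrite !ffunE.
Qed.

Definition fingrp_cat : category :=
  Category gcompidl gcompidr gcompA.

Definition order_le (U : fingrp_cat -> Prop) (n : nat) :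
    fullsub U -> Prop :=
  fun G => (#|(sval G : finGroupType)| <= n)%N.
End FiniteGroups.

Section Presheaves.
Variables (k : fieldType) (C : category).

Record psh := Psh {
  pob :> C -> lmodType k;
  pmap : forall x y, hom x y -> {linear pob y -> pob x};
  pmap_id : forall x v, pmap (idm x) v = v;
  pmap_comp : forall x y z (g : hom y z) (f : hom x y) v,
    pmap (hcomp g f) v = pmap f (pmap g v) }.

Record pshhom (X Y : psh) := PshHom {
  cpt :> forall x, {linear X x -> Y x};
  natE : forall x y (f : hom x y) v, cpt x (pmap X f v) = pmap Y f (cpt y v) }.

Definition nat_eq (X Y : psh) (f g : pshhom X Y) := forall x, f x =1 g x.

Lemma pshid_natE (X : psh) x y (f : hom x y) (v : X y) :
  (idfun : {linear X x -> X x}) (pmap X f v) =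
  pmap X f ((idfun : {linear X y -> X y}) v).
Proof. by []. Qed.

Definition pshid (X : psh) : pshhom X X :=
  @PshHom X X (fun x => idfun) (@pshid_natE X).

Lemma pshcomp_natE (X Y Z : psh) (g : pshhom Y Z) (f : pshhom X Y)
    x y (a : hom x y) (v : X y) :
  (g x \o f x) (pmap X a v) = pmap Z a ((g y \o f y) v).
Proof. by rewrite /= !natE. Qed.

Definition pshcomp (X Y Z : psh) (g : pshhom Y Z) (f : pshhom X Y) :
  pshhom X Z :=
  @PshHom X Z (fun x => g x \o f x) (@pshcomp_natE X Y Z g f).

Definition epi (X Y : psh) (f : pshhom X Y) :=
  forall (Z : psh) (g h : pshhom Y Z),
    nat_eq (pshcomp g f) (pshcomp h f) -> nat_eq g h.

Definition iso (X Y : psh) (f : pshhom X Y) :=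
  exists g : pshhom Y X,
    nat_eq (pshcomp g f) (pshid X) /\ nat_eq (pshcomp f g) (pshid Y).

(* Exactness of X -> Y -> Z at Y; kernels and images are computed objectwise. *)
Definition exact_at (X Y Z : psh) (f : pshhom X Y) (g : pshhom Y Z) :=
  forall x (v : Y x), g x v = 0 <-> exists u, f x u = v.

Definition is_zero (X : psh) := forall x (v : X x), v = 0.

(* X is the biproduct of the family Q. *)
Definition direct_sum (I : finType) (Q : I -> psh) (X : psh) :=
  exists (inj : forall i, pshhom (Q i) X) (prj : forall i, pshhom X (Q i)),
  [/\ forall i, nat_eq (pshcomp (prj i) (inj i)) (pshid (Q i)),
      forall i j x v, i != j -> prj i x (inj j x v) = 0
    & forall x v, \sum_i inj i x (prj i x v) = v].

Definition projective (P : psh) :=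
  forall (Y Z : psh) (e : pshhom Y Z) (f : pshhom P Z), epi e ->
    exists g : pshhom P Y, nat_eq (pshcomp e g) f.

Definition indecomposable (X : psh) :=
  ~ is_zero X /\
  forall Y Z : psh, direct_sum (fun b : bool => if b then Y else Z) X ->
    is_zero Y \/ is_zero Z.

Definition finitely_projective (P : psh) :=
  exists (n : nat) (Q : 'I_n -> psh),
    (forall i, indecomposable (Q i) /\ projective (Q i)) /\ direct_sum Q P.

Definition finitely_generated (X : psh) :=
  exists (P0 : psh) (e : pshhom P0 X), finitely_projective P0 /\ epi e.

Definition finitely_presented (X : psh) :=
  exists (P1 P0 : psh) (d : pshhom P1 P0) (e : pshhom P0 X),
    [/\ finitely_projective P1, finitely_projective P0,
        exact_at d e & epi e].

Definition finite_type (X : psh) :=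
  forall x, exists n, inhabited (Vector.axiom n (X x)).

End Presheaves.

Arguments pshid {k C} X.

Section Restriction.
Variables (k : fieldType) (C D : category) (i : functor C D).

Lemma restr_id (X : psh k D) x (v : X (i x)) : pmap X (fmap i (idm x)) v = v.
Proof. by rewrite fmap_id pmap_id. Qed.

Lemma restr_comp (X : psh k D) x y z (g : hom y z) (f : hom x y)
    (v : X (i z)) :
  pmap X (fmap i (hcomp g f)) v = pmap X (fmap i f) (pmap X (fmap i g) v).
Proof. by rewrite fmap_comp pmap_comp. Qed.

Definition restr (X : psh k D) : psh k C :=
  @Psh k C (fun x => X (i x)) (fun x y f => pmap X (fmap i f))
    (@restr_id X) (@restr_comp X).

Definition restr_hom (X Y : psh k D) (f : pshhom X Y) :
    pshhom (restr X) (restr Y) :=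
  @PshHom k C (restr X) (restr Y) (fun x => f (i x))
    (fun x y a v => natE f (fmap i a) v).

End Restriction.

(* A solution set for i at each object of D: every arrow d -> i c factors
   through one of a small family of such arrows.  It is there for universes
   only: finGroupType is larger than the carriers of vector spaces, so a colimit
   indexed by all arrows d -> i c would not be a vector space. *)
Record solution_set (C D : category) (i : functor C D) := SolutionSet {
  sol_idx : D -> Type;
  sol_ob : forall d, sol_idx d -> C;
  sol_arr : forall d (j : sol_idx d), hom d (i (sol_ob j));
  sol_fact : forall d c (a : hom d (i c)),
    {j : sol_idx d & {b : hom (sol_ob j) c | a = hcomp (fmap i b) (sol_arr j)}} }.

(* The left Kan extension of Y along i, given at d by the usual formula, the
   colimit of Y over the pairs (c, a : d -> i c).  An element is represented by
   a list of triples (c, a, y) with y in Y c, read as a formal sum; two lists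
   are identified when every cocone under the whole diagram gives them the same
   value.  The pairs (c, a) in the lists come from the solution set S, which
   loses nothing since (c', i(b) a, y) and (c, a, Y(b) y) are identified for
   b : c -> c'.
   [lan_adjunction] below is the universal property. *)
Section LeftKan.
Variables (k : fieldType) (C D : category) (i : functor C D).
Variables (S : solution_set i) (Y : psh k C).

Section Object.
Variable d : D.

Record lan_gen := LanGen {
  lan_idx : sol_idx S d; lan_elt : Y (sol_ob lan_idx) }.

Record cocone (V : lmodType k) := Cocone {
  leg :> forall c, hom d (i c) -> {linear Y c -> V};
  legE : forall c c' (b : hom c c') (a : hom d (i c)) (y : Y c'),
    leg (hcomp (fmap i b) a) y = leg a (pmap Y b y) }.

Definition cocone_eval V (phi : cocone V) (s : seq lan_gen) : V :=
  \sum_(t <- s) phi _ (sol_arr (lan_idx t)) (lan_elt t).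

Definition lan_pre : Type := seq lan_gen.
HB.instance Definition _ := gen_eqMixin lan_pre.
HB.instance Definition _ := gen_choiceMixin lan_pre.

Definition lan_rel : rel lan_pre := fun s t =>
  `[< forall V (phi : cocone V), cocone_eval phi s = cocone_eval phi t >].

Lemma lan_rel_refl : reflexive lan_rel. Proof. by move=> s; apply/asboolP. Qed.
Lemma lan_rel_sym : symmetric lan_rel.
Proof. by move=> s t; apply/asboolP/asboolP => st V phi; rewrite st. Qed.
Lemma lan_rel_trans : transitive lan_rel.
Proof.
move=> t s u /asboolP st /asboolP tu; apply/asboolP => V phi.
by rewrite st tu.
Qed.

Canonical lan_equiv := EquivRel lan_rel lan_rel_refl lan_rel_sym lan_rel_trans.

Definition lan_obj := {eq_quot lan_equiv}.
HB.instance Definition _ := Choice.on lan_obj.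
HB.instance Definition _ := EqQuotient.on lan_obj.

Definition lan_class (s : seq lan_gen) : lan_obj := \pi_lan_obj (s : lan_pre).

Lemma lan_classP s t : lan_class s = lan_class t <->
  forall V (phi : cocone V), cocone_eval phi s = cocone_eval phi t.
Proof.
split; first by move=> /eqmodP /asboolP.
by move=> st; apply/eqmodP/asboolP.
Qed.

Lemma lan_classK (q : lan_obj) : lan_class (repr q) = q.
Proof. exact: reprK. Qed.

Definition gen_scale (a : k) (t : lan_gen) := LanGen (a *: lan_elt t).

Lemma eval_cat V (phi : cocone V) s t :
  cocone_eval phi (s ++ t) = cocone_eval phi s + cocone_eval phi t.
Proof. exact: big_cat. Qed.

Lemma eval_scale V (phi : cocone V) a s :
  cocone_eval phi (map (gen_scale a) s) = a *: cocone_eval phi s.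
Proof.
rewrite /cocone_eval big_map scaler_sumr; apply: eq_bigr => t _.
by rewrite /= linearZ.
Qed.

Definition lan_add (q r : lan_obj) := lan_class (repr q ++ repr r).
Definition lan_scale a (q : lan_obj) := lan_class (map (gen_scale a) (repr q)).
Definition lan_zero := lan_class [::].
Definition lan_opp := lan_scale (-1).

Lemma eval_repr V (phi : cocone V) s :
  cocone_eval phi (repr (lan_class s)) = cocone_eval phi s.
Proof. by move: V phi; apply/lan_classP; rewrite lan_classK. Qed.

Lemma lan_add_class s t :
  lan_add (lan_class s) (lan_class t) = lan_class (s ++ t).
Proof. by apply/lan_classP => V phi; rewrite !eval_cat !eval_repr. Qed.

Lemma lan_scale_class a s :
  lan_scale a (lan_class s) = lan_class (map (gen_scale a) s).
Proof. by apply/lan_classP => V phi; rewrite !eval_scale !eval_repr. Qed.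

Lemma lan_addA : associative lan_add.
Proof.
by move=> p q r; apply/lan_classP => V phi;
  rewrite !eval_cat !eval_repr !eval_cat addrA.
Qed.

Lemma lan_addC : commutative lan_add.
Proof. by move=> p q; apply/lan_classP => V phi; rewrite !eval_cat addrC. Qed.

Lemma lan_add0 : left_id lan_zero lan_add.
Proof. by move=> q; rewrite -[q]lan_classK lan_add_class. Qed.

Lemma lan_addN : left_inverse lan_zero lan_opp lan_add.
Proof.
move=> q; apply/lan_classP => V phi.
by rewrite eval_cat eval_repr eval_scale scaleN1r addNr /cocone_eval big_nil.
Qed.

HB.instance Definition _ :=
  GRing.isZmodule.Build lan_obj lan_addA lan_addC lan_add0 lan_addN.

Lemma lan_scaleA a b q : lan_scale a (lan_scale b q) = lan_scale (a * b) q.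
Proof.
by apply/lan_classP => V phi; rewrite !(eval_scale, eval_repr) scalerA.
Qed.

Lemma lan_scale1 : left_id 1 lan_scale.
Proof.
move=> q; rewrite -[RHS]lan_classK; apply/lan_classP => V phi.
by rewrite eval_scale scale1r.
Qed.

Lemma lan_scaleDr : right_distributive lan_scale +%R.
Proof.
move=> a p q; apply/lan_classP => V phi.
by rewrite !(eval_scale, eval_cat, eval_repr) scalerDr.
Qed.

Lemma lan_scaleDl q : {morph lan_scale^~ q : a b / a + b}.
Proof.
move=> a b; apply/lan_classP => V phi.
by rewrite !(eval_scale, eval_cat, eval_repr) scalerDl.
Qed.

HB.instance Definition _ :=
  GRing.Zmodule_isLmodule.Build k lan_obj
    lan_scaleA lan_scale1 lan_scaleDr lan_scaleDl.

(* The linear map out of the colimit induced by a cocone. *)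
Definition lan_ind V (phi : cocone V) (q : lan_obj) : V :=
  cocone_eval phi (repr q).

Lemma lan_ind_class V (phi : cocone V) s :
  lan_ind phi (lan_class s) = cocone_eval phi s.
Proof. exact: eval_repr. Qed.

Lemma lan_ind_linear V (phi : cocone V) : linear (lan_ind phi).
Proof.
move=> a p q; rewrite /lan_ind [X in repr X]/(lan_add (lan_scale a p) q).
by rewrite eval_repr eval_cat eval_repr eval_scale.
Qed.

HB.instance Definition _ V (phi : cocone V) :=
  GRing.isLinear.Build k lan_obj V *:%R (lan_ind phi) (lan_ind_linear phi).

(* The universal cocone. *)
Definition lan_in c (a : hom d (i c)) (y : Y c) : lan_obj :=
  let: existT j (exist b _) := sol_fact S a in
  lan_class [:: LanGen (pmap Y b y)].

Lemma lan_in_class c (a : hom d (i c)) (y : Y c) V (phi : cocone V) :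
  cocone_eval phi (repr (lan_in a y)) = phi c a y.
Proof.
rewrite /lan_in; case: (sol_fact S a) => j [b ->].
by rewrite eval_repr /cocone_eval big_cons big_nil addr0 legE.
Qed.

Lemma lan_in_linear c (a : hom d (i c)) : linear (lan_in a).
Proof.
move=> u y z; rewrite [RHS]/(lan_add (lan_scale u _) _) -[LHS]lan_classK.
apply/lan_classP => V phi.
by rewrite !(eval_cat, eval_repr, eval_scale, lan_in_class) linearP.
Qed.

HB.instance Definition _ c (a : hom d (i c)) :=
  GRing.isLinear.Build k (Y c) lan_obj *:%R (lan_in a) (lan_in_linear a).

Lemma lan_inE c c' (b : hom c c') (a : hom d (i c)) (y : Y c') :
  lan_in (hcomp (fmap i b) a) y = lan_in a (pmap Y b y).
Proof.
rewrite -[LHS]lan_classK -[RHS]lan_classK.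
by apply/lan_classP => V phi; rewrite !lan_in_class legE.
Qed.

Definition lan_cocone : cocone lan_obj := @Cocone lan_obj (@lan_in) lan_inE.

Lemma lan_ind_in V (phi : cocone V) c (a : hom d (i c)) y :
  lan_ind phi (lan_in a y) = phi c a y.
Proof. exact: lan_in_class. Qed.

Lemma lan_class_sum s :
  lan_class s = \sum_(t <- s) lan_in (sol_arr (lan_idx t)) (lan_elt t).
Proof.
elim: s => [|t s IHs]; first by rewrite big_nil.
rewrite big_cons -IHs [RHS]/(lan_add _ _); apply/lan_classP => V phi.
by rewrite eval_cat eval_repr lan_in_class /cocone_eval big_cons.
Qed.

Lemma lan_ext (V : lmodType k) (f g : {linear lan_obj -> V}) :
  (forall c (a : hom d (i c)) y, f (lan_in a y) = g (lan_in a y)) -> f =1 g.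
Proof.
move=> fg q; rewrite -[q]lan_classK lan_class_sum !linear_sum.
by apply: eq_bigr => t _; rewrite fg.
Qed.

End Object.

Section Map.
Variables (d d' : D) (u : hom d d').

Lemma lan_map_legE c c' (b : hom c c') (a : hom d' (i c)) (y : Y c') :
  lan_in (hcomp (hcomp (fmap i b) a) u) y = lan_in (hcomp a u) (pmap Y b y).
Proof. by rewrite -compA lan_inE. Qed.

Definition lan_map_cocone : cocone d' (lan_obj d) :=
  @Cocone d' (lan_obj d) (fun c (a : hom d' (i c)) => @lan_in d c (hcomp a u))
    lan_map_legE.

Definition lan_map : {linear lan_obj d' -> lan_obj d} :=
  lan_ind lan_map_cocone.

Lemma lan_map_in c (a : hom d' (i c)) y :
  lan_map (lan_in a y) = lan_in (hcomp a u) y.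
Proof. exact: lan_ind_in. Qed.

End Map.

Lemma lan_map_id d (q : lan_obj d) : lan_map (idm d) q = q.
Proof.
have := @lan_ext d _ (lan_map (idm d)) idfun; apply => c a y.
by rewrite lan_map_in compidr.
Qed.

Lemma lan_map_comp d d' d'' (v : hom d' d'') (u : hom d d') (q : lan_obj d'') :
  lan_map (hcomp v u) q = lan_map u (lan_map v q).
Proof.
have := @lan_ext d'' _ (lan_map (hcomp v u)) (lan_map u \o lan_map v).
apply => c a y.
by rewrite /= !lan_map_in compA.
Qed.

Definition lan : psh k D :=
  @Psh k D (fun d => lan_obj d : lmodType k) lan_map lan_map_id lan_map_comp.

Lemma lan_unit_natE x y (f : hom x y) (v : Y y) :
  lan_in (idm (i x)) (pmap Y f v) =
  pmap (restr i lan) f (lan_in (idm (i y)) v).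
Proof. by rewrite /= lan_map_in -lan_inE compidl compidr. Qed.

Definition lan_unit : pshhom Y (restr i lan) :=
  @PshHom k C Y (restr i lan) (fun x => @lan_in (i x) x (idm (i x)))
    lan_unit_natE.

Section Transpose.
Variables (X : psh k D) (f : pshhom Y (restr i X)).

Lemma transpose_legE d c c' (b : hom c c') (a : hom d (i c)) (y : Y c') :
  (pmap X (hcomp (fmap i b) a) \o f c') y = (pmap X a \o f c) (pmap Y b y).
Proof. by rewrite /= pmap_comp natE. Qed.

Definition transpose_cocone d : cocone d (X d) :=
  @Cocone d (X d) (fun c (a : hom d (i c)) => pmap X a \o f c)
    (@transpose_legE d).

Lemma lan_transpose_natE x y (u : hom x y) (q : lan y) :
  lan_ind (transpose_cocone x) (pmap lan u q) =
  pmap X u (lan_ind (transpose_cocone y) q).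
Proof.
have := @lan_ext y _ (lan_ind (transpose_cocone x) \o lan_map u)
  (pmap X u \o lan_ind (transpose_cocone y)).
apply => c a v /=.
by rewrite lan_map_in !lan_ind_in /= pmap_comp.
Qed.

Definition lan_transpose : pshhom lan X :=
  @PshHom k D lan X (fun d => lan_ind (transpose_cocone d)) lan_transpose_natE.

End Transpose.

Theorem lan_adjunction (X : psh k D) (f : pshhom Y (restr i X)) :
  nat_eq (pshcomp (restr_hom i (lan_transpose f)) lan_unit) f /\
  forall g : pshhom lan X,
    nat_eq (pshcomp (restr_hom i g) lan_unit) f -> nat_eq g (lan_transpose f).
Proof.
split=> [c y|g gE d].
  by rewrite /= lan_ind_in /= pmap_id.
apply: lan_ext => c a y; rewrite /= lan_ind_in /= -gE /=.
rewrite -(natE g) /=.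
by rewrite lan_map_in compidl.
Qed.

End LeftKan.

Definition lan_counit (k : fieldType) (C D : category) (i : functor C D)
    (S : solution_set i) (X : psh k D) : pshhom (lan S (restr i X)) X :=
  lan_transpose S (pshid (restr i X)).

(* For the inclusion of a full subcategory of finite groups, an arrow G -> H is
   determined, up to an isomorphism of H, by its kernel. *)
Section GroupSolutionSet.
Local Open Scope group_scope.

Definition gker (G H : finGroupType) (A : gmor G H) : {set G} :=
  [set x | [exists f, (f \in val A) && (f x == 1)]].

Lemma gmor_rep (G H : finGroupType) (A : gmor G H) :
  exists f, [/\ surj_morph f, val A = conj_class f
              & gker A = [set x | f x == 1]].
Proof.
have /existsP[f /andP[sf /eqP Af]] := valP A.
exists f; split=> //; apply/setP=> x; rewrite !inE Af.
apply/existsP/eqP => [[_ /andP[/imsetP[h _ ->]]]|fx1].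
  by rewrite ffunE -{1}(conj1g h) => /eqP/conjg_inj.
exists [ffun z => f z ^ 1]; rewrite ffunE fx1 conj1g eqxx andbT.
by apply/imsetP; exists 1; rewrite ?inE.
Qed.

Lemma gker_fact (G H K : finGroupType) (A : gmor G H) (B : gmor G K) :
  gker A = gker B -> exists E : gmor H K, B = gcomp E A.
Proof.
have [f [sf Af ->]] := gmor_rep A; have [g [sg Bg ->]] := gmor_rep B.
move=> kfg.
have [fM fS] := surj_morphP _ sf; have [gM gS] := surj_morphP _ sg.
have fg x y : f x = f y -> g x = g y.
  have f1 : f 1 = 1 by apply: (mulgI (f 1)); rewrite -fM !mulg1.
  have g1 : g 1 = 1 by apply: (mulgI (g 1)); rewrite -gM !mulg1.
  move=> fxy; have : y^-1 * x \in [set z | f z == 1].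
    by rewrite inE fM fxy -fM mulVg f1.
  rewrite kfg inE gM => /eqP gxy; apply: (mulgI (g y^-1)).
  by rewrite gxy -gM mulVg g1.
pose h := [ffun y : H => g (odflt 1 [pick x | f x == y])].
have hf x : h (f x) = g x.
  rewrite ffunE; case: pickP => [z /eqP/fg //|/(_ x)]; by rewrite eqxx.
have sh : surj_morph h.
  apply/surj_morphP; split=> [y z|z].
    by have [[x <-] [x' <-]] := (fS y, fS z); rewrite -fM !hf gM.
  by have [x <-] := gS z; exists (f x).
have Eh : is_gmor (conj_class h) by apply/existsP; exists h; rewrite sh eqxx.
exists (Sub (conj_class h) Eh); apply: val_inj.
rewrite /= Af Bg gcomp_class //; congr conj_class.
by apply/ffunP=> x; rewrite ffunE hf.
Qed.

Variables (U : fingrp_cat -> Prop) (P : fullsub U -> Prop).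

Definition kernel_of (G : fullsub U) (N : {set (sval G : finGroupType)}) :=
  exists (H : fullsub P) (A : gmor (sval G) (sval (sval H))), gker A = N.

Definition kernel_choice (G : fullsub U) (N : {N | @kernel_of G N}) :
  {H : fullsub P & {A : gmor (sval G) (sval (sval H)) | gker A = sval N}} :=
  let: exist H HA := cid (svalP N) in existT _ H (cid HA).

Lemma kernel_fact (G : fullsub U) (H : fullsub P)
    (A : @hom (fullsub U) G (fullsub_incl P H)) :
  {N : {N | @kernel_of G N} &
   {E : @hom (fullsub P) (projT1 (kernel_choice N)) H |
     A = hcomp (fmap (fullsub_incl P) E) (sval (projT2 (kernel_choice N)))}}.
Proof.
have kA : @kernel_of G (gker A) by exists H, A.
exists (exist _ _ kA); apply: cid.
case: (kernel_choice _) => K [B BA] /=.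
exact: gker_fact.
Qed.

Definition group_solution_set : solution_set (fullsub_incl P) :=
  @SolutionSet _ _ (fullsub_incl P) (fun G => {N | @kernel_of G N})
    (fun G N => projT1 (kernel_choice N))
    (fun G N => sval (projT2 (kernel_choice N)))
    kernel_fact.
End GroupSolutionSet.

Section Truncation.
Variables (k : fieldType) (U : fingrp_cat -> Prop) (n : nat).

Definition incl_le : functor (fullsub (@order_le U n)) (fullsub U) :=
  fullsub_incl (@order_le U n).

Definition tau (X : psh k (fullsub U)) : psh k (fullsub U) :=
  lan (group_solution_set (@order_le U n)) (restr incl_le X).

Definition tau_counit (X : psh k (fullsub U)) : pshhom (tau X) X :=
  lan_counit (group_solution_set (@order_le U n)) X.

End Truncation.

(* Main.v *)
Require Import Defs.
From mathcomp Require Import all_boot all_order all_fingroup all_algebra.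
From mathcomp Require Import boolp classical_sets functions.
From Stdlib Require List.
From HB Require Import structures.
Import Defs.

Set Implicit Arguments.
Unset Strict Implicit.
Unset Printing Implicit Defensive.

Import GRing.Theory.

(** The order of groups grades everything: a morphism x -> y forces the order
    of y to be at most that of x, with equality only for isomorphisms, and there
    are finitely many isomorphism classes of each order. The counit of tau_n is
    onto at X exactly when X is generated by its values at groups of order at
    most n ([counit_surj]). For X of finite type this means that finitely many
    elements generate X, and conversely a finite list of generators lives in
    bounded order and forces finite type, since representables have finite
    type.

    To pass between finite lists of generators and finitely projective covers,
    two facts are needed. Each representable e_G is a finite direct sum of
    indecomposables, as its summands are seen at G, where e_G has finite
    dimension ([rep_finitely_projective]). Each indecomposable projective P is
    a quotient of a single e_G ([indecomposable_projective_yoneda_surj]): if G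
    has minimal order with P(G) nonzero, P maps onto its value at G, and Maschke's
    theorem for the outer automorphism group of G, which uses characteristic
    zero, splits off a nonzero quotient of e_G from P. This proves (a).

    For (b), a projective P generated in order at most n has an invertible
    counit, because a section of the counit is determined by its values at
    groups of order at most n ([projective_counit_inj]). Given a presentation
    P1 -> P0 -> X, the four lemma then makes the counit of X injective
    ([counit_inj_quotient]). Conversely, let P0 -> X be a cover of an X whose
    counits are invertible in large degree. Its kernel has finite type and is
    generated in bounded order ([ker_gen_le]), hence finitely generated by (a),
    and a cover P1 of the kernel completes a presentation. *)

(** * Linear algebra over a field *)

Section LinearAlgebra.
Local Open Scope ring_scope.
Variable k : fieldType.

Definition mklin (V W : lmodType k) (f : V -> W) (f_lin : linear f) :
    {linear V -> W} :=
  HB.pack f (GRing.isLinear.Build k V W *:%R f f_lin).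

(** Linear maps are often specified by choosing a preimage and checking that
    the choice is immaterial; this lemma turns such a description into a
    linear map. *)
Lemma linear_of_rel (V W : lmodType k) (R : V -> W -> Prop) :
  (forall v, exists w, R v w) ->
  (forall v w w', R v w -> R v w' -> w = w') ->
  (forall a v w v' w', R v w -> R v' w' -> R (a *: v + v') (a *: w + w')) ->
  exists f : {linear V -> W}, forall v, R v (f v).
Proof.
move=> Rex Runiq Rlin.
pose f v := sval (cid (Rex v)).
have fP v : R v (f v) by rewrite /f; case: (cid _).
have f_lin : linear f.
  by move=> a u v; apply: (Runiq (a *: u + v)) => //; apply: Rlin.
by exists (mklin f_lin).
Qed.

Definition subspace (V : lmodType k) (A : V -> Prop) :=
  A 0 /\ forall a u v, A u -> A v -> A (a *: u + v).

Lemma subspaceD (V : lmodType k) (A : V -> Prop) u v :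
  subspace A -> A u -> A v -> A (u + v).
Proof. by move=> [_ As] Au Av; rewrite -[u]scale1r; apply: As. Qed.

Lemma subspaceZ (V : lmodType k) (A : V -> Prop) a u :
  subspace A -> A u -> A (a *: u).
Proof. by move=> [A0 As] Au; rewrite -[a *: u]addr0; apply: As. Qed.

Lemma subspaceB (V : lmodType k) (A : V -> Prop) u v :
  subspace A -> A u -> A v -> A (u - v).
Proof. by move=> [_ As] Au Av; rewrite addrC -scaleN1r; apply: As. Qed.

Lemma subspace_sum (V : lmodType k) (A : V -> Prop) I (r : seq I) (P : pred I) F :
  subspace A -> (forall i, P i -> A (F i)) -> A (\sum_(i <- r | P i) F i).
Proof.
move=> sA AF; elim/big_rec: _ => [|i v Pi Av]; first by case: sA.
by apply: subspaceD => //; apply: AF.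
Qed.

(** A maximal H meeting A only in 0, given by Zorn, is a complement: if v is
    outside H + A, then the span of H and v still meets A trivially, since a
    vector a v + h of A with a invertible would put v in H + A. *)
Lemma subspace_complement (V : lmodType k) (A : V -> Prop) : subspace A ->
  exists H : V -> Prop, [/\ subspace H, forall v, H v -> A v -> v = 0
    & forall v, exists2 h, H h & A (v - h)].
Proof.
move=> sA; have [A0 As] := sA.
pose P (H : set V) := (forall a u v, H u -> H v -> H (a *: u + v)) /\
  (forall v, H v -> A v -> v = 0).
have [|H [[HS HA] Hmax]] := @Zorn_bigcup V P.
  move=> F FP Ftot; split=> [a u v [X FX Xu] [Y FY Yv]|v [X FX Xv]]; last first.
    by have [_] := FP _ FX; apply.
  have [XY|YX] := Ftot _ _ FX FY.
    by exists Y => //; have [+ _] := FP _ FY; apply=> //; apply: XY.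
  by exists X => //; have [+ _] := FP _ FX; apply=> //; apply: YX.
have H0 : H 0.
  apply: contrapT => nH0.
  have H_empty u : ~ H u.
    by move=> Hu; apply: nH0; rewrite -(addNr u) -scaleN1r; apply: HS.
  apply: (Hmax (fun v => v = 0)).
    split=> [u /H_empty //|/(_ 0 erefl)]; exact: H_empty.
  by split=> // a u v -> ->; rewrite scaler0 addr0.
exists H; split=> // v.
apply: contrapT => nv.
pose H' w := exists a h, H h /\ w = a *: v + h.
apply: (Hmax H').
  split=> [h Hh|sub]; first by exists 0, h; rewrite scale0r add0r.
  apply: nv; exists v; last by rewrite subrr.
  by apply: sub; exists 1, 0; rewrite scale1r addr0.
split=> [c _ _ [a [h [Hh ->]]] [b [g [Hg ->]]]|w [a [h [Hh ->]]] Aw].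
  exists (c * a + b), (c *: h + g); split; first exact: HS.
  by rewrite scalerDr scalerDl scalerA addrACA.
have [a0|a0] := eqVneq a 0.
  by move: Aw; rewrite a0 scale0r add0r => /(HA _ Hh).
exfalso; apply: nv; exists (- a^-1 *: h).
  by apply: (subspaceZ _ (conj H0 HS)).
have -> : v - - a^-1 *: h = a^-1 *: (a *: v + h).
  by rewrite scaleNr opprK scalerDr scalerA mulVf // scale1r.
exact: subspaceZ.
Qed.

(** The projection onto a complement of A along A. Its kernel is exactly A, so
    that it serves as a quotient map by A with values in V itself. *)
Lemma subspace_projector (V : lmodType k) (A : V -> Prop) : subspace A ->
  exists p : {linear V -> V},
    (forall v, A v -> p v = 0) /\ (forall v, A (v - p v)).
Proof.
move=> sA; have [H [sH HA HV]] := subspace_complement sA.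
have [v|v h h' [Hh Ah] [Hh' Ah']|a v w v' w' [Hw Aw] [Hw' Aw']|p pP] :=
    @linear_of_rel V V (fun v h => H h /\ A (v - h)).
- by have [h Hh Ah] := HV v; exists h.
- apply/eqP; rewrite -subr_eq0; apply/eqP/HA; first exact: subspaceB.
  have -> : h - h' = (v - h') - (v - h).
    by rewrite opprB [RHS]addrC addrA subrK.
  exact: subspaceB.
- split; first by case: sH => _; apply.
  by rewrite opprD addrACA -scalerBr; case: sA => _; apply.
exists p; split=> v; last by case: (pP v).
move=> Av; have [Hp Ap] := pP v; apply: HA => //.
by rewrite -[p v](subKr v); apply: subspaceB.
Qed.

Lemma subspace_ker (V W : lmodType k) (f : {linear V -> W}) :
  subspace (fun v => f v = 0).
Proof.
by split=> [|a u v fu fv]; rewrite ?linear0 ?linearP // fu fv scaler0 addr0.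
Qed.

Lemma subspace_image (V W : lmodType k) (f : {linear V -> W}) :
  subspace (fun w => exists v, f v = w).
Proof.
split=> [|a _ _ [u <-] [v <-]]; first by exists 0; rewrite linear0.
by exists (a *: u + v); rewrite linearP.
Qed.

Lemma subspace_preim (V W : lmodType k) (f : {linear V -> W}) (A : W -> Prop) :
  subspace A -> subspace (fun v => A (f v)).
Proof.
move=> [A0 As]; split=> [|a u v fu fv]; first by rewrite linear0.
by rewrite linearP; apply: As.
Qed.

(** Composite of a projection of W onto the image of f and of the inverse of f
    from the image to a complement of its kernel. *)
Lemma generalized_inverse (V W : lmodType k) (f : {linear V -> W}) :
  exists g : {linear W -> V}, forall v, f (g (f v)) = f v.
Proof.
have [p [p_im imp]] := subspace_projector (subspace_image f).
have [q [q_ker kerq]] := subspace_projector (subspace_ker f).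
have fq v : f (q v) = f v.
  by apply/esym/eqP; rewrite -subr_eq0 -linearB; apply/eqP/kerq.
pose R w u := exists v, f v = w - p w /\ u = q v.
have [w|w u u' [v [fv ->]] [v' [fv' ->]]
     |a w u w' u' [v [fv ->]] [v' [fv' ->]]|g gP] :=
    @linear_of_rel W V R.
- by have [v fv] := imp w; exists (q v), v.
- apply/eqP; rewrite -subr_eq0 -linearB; apply/eqP/q_ker.
  by rewrite linearB fv fv' subrr.
- exists (a *: v + v'); split; last by rewrite linearP.
  by rewrite (linearP f) (linearP p) fv fv' scalerBr opprD addrACA.
exists g => v; have [v' [fv' ->]] := gP (f v).
by rewrite fq fv' p_im ?subr0 //; exists v.
Qed.

Definition finite_dim (V : lmodType k) := exists n, inhabited (Vector.axiom n V).

(** Any list whose image spans a subspace of maximal dimension will do, and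
    dimensions are bounded by that of V. *)
Lemma span_sub_inj (W : lmodType k) (V : vectType k) (g : {linear W -> V}) :
  exists s : seq W, forall w, g w \in <<map g s>>%VS.
Proof.
have mono s w : (\dim <<map g s>> < \dim <<map g (w :: s)>>)%N \/
    g w \in <<map g s>>%VS.
  have ss : (<<map g s>> <= <<map g (w :: s)>>)%VS.
    by apply: sub_span => x; rewrite inE orbC => ->.
  have [le_d eq_d] := dimv_leqif_sup ss.
  have [lt_d|ge_d] := ltnP (\dim <<map g s>>) (\dim <<map g (w :: s)>>).
    by left.
  right; have /subvP : (<<map g (w :: s)>> <= <<map g s>>)%VS.
    by rewrite -eq_d eqn_leq le_d ge_d.
  by apply; rewrite memv_span //= inE eqxx.
apply: contrapT => nex.
have step s : exists w, (\dim <<map g s>> < \dim <<map g (w :: s)>>)%N.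
  apply: contrapT => nw; apply: nex; exists s => w.
  by have [lt_d|//] := mono s w; case: nw; exists w.
have big n : exists s, (n <= \dim <<map g s>>)%N.
  elim: n => [|n [s sn]]; first by exists [::].
  by have [w lt_d] := step s; exists (w :: s); apply: leq_ltn_trans lt_d.
have [s] := big (\dim {: V}).+1.
by rewrite ltnNge dimvS ?subvf.
Qed.

(** The image of g is the span of the list given by span_sub_inj; coordinates
    on a basis of this span are coordinates on W. *)
Lemma finite_dim_inj (W : lmodType k) (V : vectType k) (g : {linear W -> V}) :
  injective g -> finite_dim W.
Proof.
move=> g_inj; have [s sP] := span_sub_inj g.
pose L := <<map g s>>%VS.
have imL v : v \in L -> exists w, g w = v.
  pose t := in_tuple (map g s).
  move=> vL; rewrite (@coord_span _ _ _ t _ vL).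
  exists (\sum_(i < size (map g s)) coord t i v *: s`_i).
  rewrite linear_sum; apply: eq_bigr => i _.
  by rewrite linearZ /= (nth_map 0) // -(size_map g).
exists (\dim L); constructor.
pose h w := (\row_(i < \dim L) coord (vbasis L) i (g w) : 'rV[k]_(\dim L)).
exists h.
  by move=> a u v; apply/rowP => i; rewrite !mxE !linearP.
have hB w : g w = \sum_(i < \dim L) h w 0 i *: (vbasis L)`_i.
  rewrite {1}(coord_vbasis (sP w)).
  by apply: eq_bigr => i _; rewrite mxE.
have ex (r : 'rV_(\dim L)) :
    exists w, g w = \sum_(i < \dim L) r 0 i *: (vbasis L)`_i.
  apply: imL; apply: memv_suml => i _; apply: memvZ.
  by apply: vbasis_mem; apply: mem_nth; rewrite size_tuple.
exists (fun r => sval (cid (ex r))) => [w|r]; case: cid => /= u gu.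
  by apply: g_inj; rewrite gu -hB.
apply/rowP => i; rewrite mxE gu.
by rewrite coord_sum_free //; apply: basis_free; apply: vbasisP.
Qed.

Lemma finite_dim_vectType (V : vectType k) : finite_dim V.
Proof. exact: (@finite_dim_inj V V idfun). Qed.

(** A generalized inverse of f embeds W into V. *)
Lemma finite_dim_surj (V : vectType k) (W : lmodType k) (f : {linear V -> W}) :
  (forall w, exists v, f v = w) -> finite_dim W.
Proof.
move=> fS; have [g gK] := generalized_inverse f.
apply: (@finite_dim_inj W V g); apply: (can_inj (g := f)) => w.
by have [v <-] := fS w.
Qed.

Lemma finite_dim_vect (W : lmodType k) : finite_dim W ->
  exists (V : vectType k) (f : {linear V -> W}) (g : {linear W -> V}),
    cancel f g /\ cancel g f.
Proof.
move=> [n [[v2r v2r_lin [r2v v2rK r2vK]]]].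
have r2v_lin : linear r2v.
  by move=> a u v; apply: (can_inj v2rK); rewrite v2r_lin !r2vK.
by exists 'rV[k]_n, (mklin r2v_lin), (mklin v2r_lin).
Qed.

Lemma finite_dim_sub (W W' : lmodType k) (g : {linear W' -> W}) :
  injective g -> finite_dim W -> finite_dim W'.
Proof.
move=> g_inj /finite_dim_vect[V [f [h [fK hK]]]].
by apply: (@finite_dim_inj W' V (h \o g)); apply: inj_comp => //; apply: can_inj hK.
Qed.

Lemma finite_dim_quo (W W' : lmodType k) (g : {linear W -> W'}) :
  (forall w, exists v, g v = w) -> finite_dim W -> finite_dim W'.
Proof.
move=> gS /finite_dim_vect[V [f [h [fK hK]]]].
apply: (@finite_dim_surj V W' (g \o f)) => w.
by have [v <-] := gS w; exists (h v); rewrite /= hK.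
Qed.

Lemma finite_dim_prod (W W' : lmodType k) :
  finite_dim W -> finite_dim W' -> finite_dim (W * W')%type.
Proof.
move=> /finite_dim_vect[V [f [g [fK gK]]]] /finite_dim_vect[V' [f' [g' [fK' gK']]]].
have h_lin : linear (fun w : W * W' => (g w.1, g' w.2)).
  by move=> a [u u'] [v v'] /=; rewrite !linearP.
apply: (@finite_dim_inj _ _ (mklin h_lin)) => -[u u'] [v v'] [].
by move=> /(can_inj gK) -> /(can_inj gK') ->.
Qed.

Lemma finite_dim_span (W : lmodType k) : finite_dim W ->
  exists s : seq W, forall A, subspace A -> List.Forall A s -> forall w, A w.
Proof.
move=> /finite_dim_vect[V [f [g [fK gK]]]].
have [s sP] := span_sub_inj g.
exists s => A sA As w.
rewrite -[w]gK (@coord_span _ _ _ (in_tuple (map g s)) _ (sP w)) linear_sum.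
apply: subspace_sum => // i _; rewrite linearZ.
apply: subspaceZ => //; case: i => i /=; rewrite size_map => lt_i.
rewrite (nth_map 0) // gK.
by elim: As i lt_i => [//|x t Ax _ IH] [|i] //=; apply: IH.
Qed.

Section SubspaceType.
Variables (V : lmodType k) (A : V -> Prop).

(** The proof that A is a subspace is an argument so that the closure instance
    below, keyed on in_subspace, can depend on it. *)
Definition in_subspace (_ : subspace A) : {pred V} := fun v => `[< A v >].

Variable sA : subspace A.

Lemma in_subspace_closed : submod_closed (in_subspace sA).
Proof.
split=> [|a u v /asboolP Au /asboolP Av]; apply/asboolP; case: sA => //.
by move=> _; apply.
Qed.

HB.instance Definition _ :=
  GRing.isSubmodClosed.Build k V (in_subspace sA) in_subspace_closed.

Record subspace_type := SubspaceElt {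
  subspace_val :> V; _ : subspace_val \in in_subspace sA }.

HB.instance Definition _ := [isSub for subspace_val].
HB.instance Definition _ := [Choice of subspace_type by <:].
HB.instance Definition _ := [SubChoice_isSubLmodule of subspace_type by <:].

Lemma subspace_val_inj : injective subspace_val.
Proof. exact: val_inj. Qed.

Lemma subspaceP (v : subspace_type) : A v.
Proof. by case: v => v /= /asboolP. Qed.

Definition subspace_elt v (Av : A v) : subspace_type :=
  SubspaceElt (asboolT Av : v \in in_subspace sA).

Definition subspace_incl : {linear subspace_type -> V} :=
  (\val : subspace_type -> V).

End SubspaceType.

Section FreeModule.
Variables (T : finType) (V : lmodType k).

Definition basis_fun (a : T) : {ffun T -> k^o} := [ffun b => (b == a)%:R].

Lemma basis_fun_sum (u : {ffun T -> k^o}) : u = \sum_a u a *: basis_fun a.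
Proof.
apply/ffunP => b; rewrite sum_ffunE (bigD1 b) //= big1 => [|a ab].
  by rewrite !ffunE eqxx /= addr0 /GRing.scale /= mulr1.
by rewrite !ffunE eq_sym (negPf ab) scaler0.
Qed.

Variable F : T -> V.

Definition lin_ext (u : {ffun T -> k^o}) : V := \sum_a u a *: F a.

Lemma lin_ext_linear : linear lin_ext.
Proof.
move=> c u v; rewrite /lin_ext scaler_sumr -big_split; apply: eq_bigr => a _.
by rewrite !ffunE scalerDl scalerA.
Qed.

HB.instance Definition _ :=
  GRing.isLinear.Build k {ffun T -> k^o} V *:%R lin_ext lin_ext_linear.

Lemma lin_ext_delta a : lin_ext (basis_fun a) = F a.
Proof.
rewrite /lin_ext /= (bigD1 a) //= big1 => [|b ba].
  by rewrite ffunE eqxx scale1r addr0.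
by rewrite ffunE (negPf ba) scale0r.
Qed.

Lemma lin_ext_unique (f g : {linear {ffun T -> k^o} -> V}) :
  (forall a, f (basis_fun a) = g (basis_fun a)) -> f =1 g.
Proof.
move=> fg u; rewrite (basis_fun_sum u) !linear_sum; apply: eq_bigr => a _.
by rewrite !linearZ fg.
Qed.

End FreeModule.

End LinearAlgebra.

Arguments lin_ext : simpl never.

(** * Presheaves of vector spaces *)

Section Presheaves.
Local Open Scope ring_scope.
Variables (k : fieldType) (C : category).
Implicit Types X Y Z P Q : psh k C.

Section Coinduced.
Variables (G : C) (V : lmodType k).

Definition coind_map x y (f : hom x y) (u : hom G y -> V) : hom G x -> V :=
  fun a => u (hcomp f a).

Lemma coind_map_linear x y (f : hom x y) : linear (coind_map f).
Proof. by []. Qed.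

Lemma coind_map_id x (u : hom G x -> V) : coind_map (idm x) u = u.
Proof. by apply/funext => a; rewrite /coind_map compidl. Qed.

Lemma coind_map_comp x y z (g : hom y z) (f : hom x y) (u : hom G z -> V) :
  coind_map (hcomp g f) u = coind_map f (coind_map g u).
Proof. by apply/funext => a; rewrite /coind_map compA. Qed.

(** The right adjoint of evaluation at G, applied to V: maps from a presheaf Y
    to it correspond to linear maps from Y(G) to V. *)
Definition coind : psh k C :=
  @Psh k C (fun x => (hom G x -> V) : lmodType k)
    (fun x y f => mklin (@coind_map_linear x y f)) coind_map_id coind_map_comp.

Variables (Y : psh k C) (l : {linear Y G -> V}).

Definition coind_cpt x (y : Y x) : hom G x -> V := fun a => l (pmap Y a y).

Lemma coind_cpt_linear x : linear (@coind_cpt x).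
Proof. by move=> a u v; apply/funext => f; rewrite /coind_cpt !linearP. Qed.

Lemma coind_cpt_natE x y (f : hom x y) v :
  coind_cpt (pmap Y f v) = coind_map f (coind_cpt v).
Proof. by apply/funext => a; rewrite /coind_cpt /coind_map pmap_comp. Qed.

Definition coind_hom : pshhom Y coind :=
  @PshHom k C Y coind (fun x => mklin (@coind_cpt_linear x)) coind_cpt_natE.

End Coinduced.

Definition pshsurj X Y (f : pshhom X Y) := forall x w, exists v, f x v = w.
Definition pshinj X Y (f : pshhom X Y) := forall x v, f x v = 0 -> v = 0.

Lemma pshsurj_epi X Y (f : pshhom X Y) : pshsurj f -> epi f.
Proof. by move=> fS Z g h gh x w; have [v <-] := fS x w; apply: gh. Qed.

(** Let p be a linear map on Y(x) whose kernel is the image of f. Composed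
    with f, the map Y -> coind given by p agrees with the zero map; hence p =
    0, and the image is everything. Maps into a coinduced presheaf thus play
    the role of the quotient of Y by the image of f. *)
Lemma epi_pshsurj X Y (f : pshhom X Y) : epi f -> pshsurj f.
Proof.
move=> f_epi x w; have [p [p_im imp]] := subspace_projector (subspace_image (f x)).
(* p kills the image of f and differs from the identity by elements of it. *)
pose g := coind_hom p; pose h : pshhom Y _ := coind_hom (\0%R : {linear Y x -> Y x}).
have /f_epi/(_ x w) : nat_eq (pshcomp g f) (pshcomp h f).
  move=> y v; apply/funext => a /=; rewrite /coind_cpt -natE p_im //.
  by exists (pmap X a v).
move/(congr1 (fun u => u (idm x))); rewrite /= /coind_cpt pmap_id => pw.
by have := imp w; rewrite pw subr0.
Qed.

Lemma iso_pshbij X Y (f : pshhom X Y) : iso f <-> pshinj f /\ pshsurj f.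
Proof.
split=> [[g [gf fg]]|[fI fS]].
  split=> [x v fv|x w]; first by rewrite -[v](gf x) /= fv linear0.
  by exists (g x w); apply: fg.
have finj x : injective (f x).
  move=> u v fuv; apply/eqP; rewrite -subr_eq0; apply/eqP/(fI x).
  by rewrite linearB fuv subrr.
pose g x w := sval (cid (fS x w)).
have fg x w : f x (g x w) = w by rewrite /g; case: cid.
have g_lin x : linear (@g x).
  by move=> a u v; apply: (finj x); rewrite linearP !fg.
have g_nat x y (a : hom x y) v : g x (pmap Y a v) = pmap X a (g y v).
  by apply: (finj x); rewrite natE !fg.
exists (@PshHom k C Y X (fun x => mklin (g_lin x)) g_nat).
by split=> x v /=; [apply: (finj x)|]; rewrite fg.
Qed.

Record subpsh X := SubPsh {
  sub_at :> forall x, X x -> Prop;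
  sub_lin : forall x, subspace (@sub_at x);
  sub_pull : forall x y (f : hom x y) v, sub_at v -> sub_at (pmap X f v) }.

Section SubPresheaf.
Variables (X : psh k C) (A : subpsh X).

Definition sub_map x y (f : hom x y) (v : subspace_type (sub_lin A y)) :
    subspace_type (sub_lin A x) :=
  subspace_elt (sub_lin A x) (sub_pull f (subspaceP v)).

Lemma sub_map_linear x y (f : hom x y) : linear (sub_map f).
Proof. by move=> a u v; apply: val_inj; rewrite /= !linearP. Qed.

Lemma sub_map_id x v : sub_map (idm x) v = v.
Proof. by apply: val_inj; rewrite /= pmap_id. Qed.

Lemma sub_map_comp x y z (g : hom y z) (f : hom x y) v :
  sub_map (hcomp g f) v = sub_map f (sub_map g v).
Proof. by apply: val_inj; rewrite /= pmap_comp. Qed.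

Definition psh_of_sub : psh k C :=
  @Psh k C (fun x => subspace_type (sub_lin A x) : lmodType k)
    (fun x y f => mklin (@sub_map_linear x y f)) sub_map_id sub_map_comp.

Definition sub_incl : pshhom psh_of_sub X :=
  @PshHom k C psh_of_sub X (fun x => subspace_incl (sub_lin A x))
    (fun x y f v => erefl).

Lemma sub_inclP x v : A x (sub_incl x v).
Proof. exact: subspaceP. Qed.

Lemma sub_incl_inj x : injective (sub_incl x).
Proof. exact: subspace_val_inj. Qed.

Lemma sub_incl_ex x v : A x v -> exists u, sub_incl x u = v.
Proof. by move=> Av; exists (subspace_elt (sub_lin A x) Av). Qed.

Variables (Y : psh k C) (f : pshhom Y X) (fA : forall x v, A x (f x v)).

Definition corestr_cpt x v : subspace_type (sub_lin A x) :=
  subspace_elt (sub_lin A x) (fA v).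

Lemma corestr_linear x : linear (@corestr_cpt x).
Proof. by move=> a u v; apply: val_inj; rewrite /= linearP. Qed.

Lemma corestr_natE x y (a : hom x y) v :
  corestr_cpt (pmap Y a v) = sub_map a (corestr_cpt v).
Proof. by apply: val_inj; rewrite /= natE. Qed.

Definition corestr : pshhom Y psh_of_sub :=
  @PshHom k C Y psh_of_sub (fun x => mklin (@corestr_linear x)) corestr_natE.

Lemma corestrE x v : sub_incl x (corestr x v) = f x v.
Proof. by []. Qed.

End SubPresheaf.

Lemma preim_pull X Y (f : pshhom X Y) (B : subpsh Y) x y (a : hom x y) v :
  B _ (f y v) -> B _ (f x (pmap X a v)).
Proof. by rewrite natE; apply: sub_pull. Qed.

Definition preim_subpsh X Y (f : pshhom X Y) (B : subpsh Y) : subpsh X :=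
  @SubPsh X (fun x v => B x (f x v))
    (fun x => subspace_preim (f x) (sub_lin B x)) (@preim_pull X Y f B).

Lemma image_pull X Y (f : pshhom X Y) x y (a : hom x y) w :
  (exists v, f y v = w) -> exists v, f x v = pmap Y a w.
Proof. by move=> [v <-]; exists (pmap X a v); rewrite natE. Qed.

Definition image_subpsh X Y (f : pshhom X Y) : subpsh Y :=
  @SubPsh Y (fun x w => exists v, f x v = w)
    (fun x => subspace_image (f x)) (@image_pull X Y f).

Lemma ker_pull X Y (f : pshhom X Y) x y (a : hom x y) v :
  f y v = 0 -> f x (pmap X a v) = 0.
Proof. by move=> fv; rewrite natE fv linear0. Qed.

Definition ker_subpsh X Y (f : pshhom X Y) : subpsh X :=
  @SubPsh X (fun x v => f x v = 0)
    (fun x => subspace_ker (f x)) (@ker_pull X Y f).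

(** The lifting property against the epimorphism from Y onto its image. *)
Lemma projective_lift P Y Z (e : pshhom Y Z) (f : pshhom P Z) :
  projective P -> (forall x v, exists y, e x y = f x v) ->
  exists g : pshhom P Y, forall x v, e x (g x v) = f x v.
Proof.
move=> projP f_im.
have eA x v : image_subpsh e x (e x v) by exists v.
have fA x v : image_subpsh e x (f x v) by apply: f_im.
have e_epi : epi (corestr eA).
  apply: pshsurj_epi => x w; have [v ev] := sub_inclP w.
  by exists v; apply: sub_incl_inj; rewrite corestrE.
have [g gP] := projP _ _ (corestr eA) (corestr fA) e_epi.
by exists g => x v; have /(congr1 (sub_incl _ x)) := gP x v.
Qed.

Lemma projective_retract P Q (i : pshhom Q P) (p : pshhom P Q) :
  projective P -> nat_eq (pshcomp p i) (pshid Q) -> projective Q.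
Proof.
move=> projP pi Y Z e f e_epi.
have [g gP] := projP Y Z e (pshcomp f p) e_epi.
exists (pshcomp g i) => x v; have := gP x (i x v).
by rewrite /= => ->; rewrite [p x _]pi.
Qed.

Lemma pshsum_linear (I : finType) X Y (F : I -> pshhom X Y) x :
  linear (fun v => \sum_i F i x v).
Proof.
move=> a u v; rewrite scaler_sumr -big_split.
by apply: eq_bigr => i _; rewrite linearP.
Qed.

Lemma pshsum_natE (I : finType) X Y (F : I -> pshhom X Y) x y (a : hom x y) v :
  \sum_i F i x (pmap X a v) = pmap Y a (\sum_i F i y v).
Proof. by rewrite linear_sum; apply: eq_bigr => i _; rewrite natE. Qed.

Definition pshsum (I : finType) X Y (F : I -> pshhom X Y) : pshhom X Y :=
  @PshHom k C X Y (fun x => mklin (@pshsum_linear I X Y F x)) (pshsum_natE F).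

Lemma direct_sum_projective (I : finType) (Q : I -> psh k C) X :
  direct_sum Q X -> (forall i, projective (Q i)) -> projective X.
Proof.
move=> [inj [prj [prjK prj0 sumK]]] projQ Y Z e f e_epi.
pose g i := sval (cid (projQ i Y Z e (pshcomp f (inj i)) e_epi)).
have gP i x v : e x (g i x v) = f x (inj i x v).
  by rewrite /g; case: cid => h /= /(_ x v).
exists (pshsum (fun i => pshcomp (g i) (prj i))) => x v /=.
rewrite linear_sum -{2}[v]sumK linear_sum.
by apply: eq_bigr => i _; rewrite gP.
Qed.

Lemma direct_sum2 X Y Z (iY : pshhom Y X) (pY : pshhom X Y)
    (iZ : pshhom Z X) (pZ : pshhom X Z) :
  (forall x v, pY x (iY x v) = v) -> (forall x v, pZ x (iZ x v) = v) ->
  (forall x v, pY x (iZ x v) = 0) -> (forall x v, pZ x (iY x v) = 0) ->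
  (forall x v, iY x (pY x v) + iZ x (pZ x v) = v) ->
  direct_sum (fun b : bool => if b then Y else Z) X.
Proof.
move=> YY ZZ YZ ZY tot.
exists (fun b => if b return pshhom (if b then Y else Z) X then iY else iZ).
exists (fun b => if b return pshhom X (if b then Y else Z) then pY else pZ).
split=> [[] x v|[] [] //|x v]; first exact: YY.
- exact: ZZ.
- by rewrite big_bool; apply: tot.
Qed.

(** P is the direct sum of the image and the kernel of an idempotent. *)
Lemma indecomposable_idem P (t : pshhom P P) : indecomposable P ->
  nat_eq (pshcomp t t) t ->
  (forall x v, t x v = 0) \/ (forall x v, t x v = v).
Proof.
move=> [_ indP] tt.
have tT x v : t x (t x v) = t x v by apply: tt.
have F_lin x : subspace (fun v => t x v = v).
  by split=> [|a u v tu tv]; rewrite ?linear0 ?linearP ?tu ?tv.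
have F_pull x y (a : hom x y) v : t y v = v -> t x (pmap P a v) = pmap P a v.
  by rewrite natE => ->.
pose A := SubPsh F_lin F_pull; pose B := ker_subpsh t.
have tA x v : A x (t x v) by apply: tT.

have cl x : linear (fun v => v - t x v).
  by move=> a u v; rewrite linearP opprD addrACA scalerBr.
have cn x y (a : hom x y) v : pmap P a v - t x (pmap P a v) = pmap P a (v - t y v).
  by rewrite linearB natE.
pose c := @PshHom k C P P (fun x => mklin (cl x)) cn.
have cB x v : B x (c x v) by rewrite /= linearB tT subrr.
have dsum : direct_sum (fun b : bool => if b then psh_of_sub A else psh_of_sub B) P.
  apply: (@direct_sum2 _ _ _ (sub_incl A) (corestr tA) (sub_incl B) (corestr cB)).
  - by move=> x v; apply: sub_incl_inj; rewrite corestrE; apply: (sub_inclP v).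
  - move=> x v; apply: sub_incl_inj; rewrite corestrE /=.
    by have /= -> := sub_inclP v; rewrite subr0.
  - by move=> x v; apply: sub_incl_inj; rewrite corestrE linear0; apply: (sub_inclP v).
  - move=> x v; apply: sub_incl_inj; rewrite corestrE linear0 /=.
    by have /= -> := sub_inclP v; rewrite subrr.
  - by move=> x v; rewrite !corestrE /= addrC subrK.
have [A0|B0] := indP _ _ dsum; [left|right] => x v.
  by have := A0 x (corestr tA x v) => /(congr1 (sub_incl A x)); rewrite linear0.
have := B0 x (corestr cB x v) => /(congr1 (sub_incl B x)).
by rewrite linear0 => /eqP; rewrite subr_eq0 => /eqP.
Qed.

Definition psh_zero : psh k C :=
  @Psh k C (fun x => 'rV[k]_0 : lmodType k) (fun x y f => idfun)
    (fun x v => erefl) (fun x y z g f v => erefl).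

Lemma psh_zeroP : is_zero psh_zero.
Proof. by move=> x v; apply/rowP => -[]. Qed.

Section Product.
Variables P Q : psh k C.

Lemma prod_map_linear x y (f : hom x y) :
  linear (fun v : (P y * Q y)%type => (pmap P f v.1, pmap Q f v.2)).
Proof. by move=> a u v; rewrite /= !linearP. Qed.

Lemma prod_map_id x (v : (P x * Q x)%type) :
  (pmap P (idm x) v.1, pmap Q (idm x) v.2) = v.
Proof. by case: v => u v; rewrite !pmap_id. Qed.

Lemma prod_map_comp x y z (g : hom y z) (f : hom x y) (v : (P z * Q z)%type) :
  (pmap P (hcomp g f) v.1, pmap Q (hcomp g f) v.2) =
  (pmap P f (pmap P g v.1), pmap Q f (pmap Q g v.2)).
Proof. by rewrite !pmap_comp. Qed.

Definition psh_prod : psh k C :=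
  @Psh k C (fun x => (P x * Q x)%type : lmodType k)
    (fun x y f => mklin (@prod_map_linear x y f)) prod_map_id prod_map_comp.

Lemma psh_inl_linear x : linear (fun v : P x => (v, 0 : Q x)).
Proof. by move=> a u v; congr (_, _); rewrite /= scaler0 addr0. Qed.
Lemma psh_inr_linear x : linear (fun v : Q x => (0 : P x, v)).
Proof. by move=> a u v; congr (_, _); rewrite /= scaler0 addr0. Qed.

Lemma psh_inl_natE x y (f : hom x y) (v : P y) :
  (pmap P f v, 0) = (pmap P f v, pmap Q f 0).
Proof. by rewrite linear0. Qed.
Lemma psh_inr_natE x y (f : hom x y) (v : Q y) :
  (0, pmap Q f v) = (pmap P f 0, pmap Q f v).
Proof. by rewrite linear0. Qed.

Definition psh_inl : pshhom P psh_prod :=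
  @PshHom k C P psh_prod (fun x => mklin (@psh_inl_linear x)) psh_inl_natE.
Definition psh_inr : pshhom Q psh_prod :=
  @PshHom k C Q psh_prod (fun x => mklin (@psh_inr_linear x)) psh_inr_natE.
Definition psh_fst : pshhom psh_prod P :=
  @PshHom k C psh_prod P (fun x => fst) (fun x y f v => erefl).
Definition psh_snd : pshhom psh_prod Q :=
  @PshHom k C psh_prod Q (fun x => snd) (fun x y f v => erefl).

Lemma psh_prod_sum : direct_sum (fun b : bool => if b then P else Q) psh_prod.
Proof.
apply: (@direct_sum2 _ _ _ psh_inl psh_fst psh_inr psh_snd) => // x [u v].
by rewrite /=; congr (_, _); rewrite ?addr0 ?add0r.
Qed.

End Product.

Lemma finitely_projective_fin (I : finType) (Q : I -> psh k C) P :
  (forall i, indecomposable (Q i) /\ projective (Q i)) -> direct_sum Q P ->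
  finitely_projective P.
Proof.
move=> Qok [inj [prj [prjK prj0 sumK]]].
exists #|I|, (fun i => Q (enum_val i)); split=> [i|]; first exact: Qok.
exists (fun i => inj (enum_val i)), (fun i => prj (enum_val i)).
split=> [i x v|i j x v ij|x v]; first exact: prjK.
  by apply: prj0; apply: contra ij => /eqP/enum_val_inj->.
by rewrite -[RHS]sumK [RHS](reindex _ (onW_bij _ (@enum_val_bij I))).
Qed.

Lemma finitely_projective_zero P : is_zero P -> finitely_projective P.
Proof.
move=> P0; apply: (@finitely_projective_fin void (fun _ => P)); first by case.
exists (fun _ => pshid P), (fun _ => pshid P); split=> [[]|[]|x v].
by rewrite (P0 x v) big1 // => -[].
Qed.

Lemma finitely_projective1 P :
  indecomposable P -> projective P -> finitely_projective P.
Proof.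
move=> indP projP; apply: (@finitely_projective_fin unit (fun _ => P)) => //.
exists (fun _ => pshid P), (fun _ => pshid P); split=> [//|[] [] //|x v].
by rewrite (big_pred1 tt) // => -[].
Qed.

Lemma finitely_projective_sum Y Z P :
  direct_sum (fun b : bool => if b then Y else Z) P ->
  finitely_projective Y -> finitely_projective Z -> finitely_projective P.
Proof.
move=> [inj [prj [prjK prj0 sumK]]].
move=> [n [Q [Qok [injQ [prjQ [prjKQ prj0Q sumKQ]]]]]].
move=> [m [R [Rok [injR [prjR [prjKR prj0R sumKR]]]]]].
pose S (i : 'I_n + 'I_m) := match i with inl i => Q i | inr j => R j end.
apply: (@finitely_projective_fin _ S); first by case=> i; [apply: Qok|apply: Rok].
exists (fun i => match i return pshhom (S i) P with
  inl i => pshcomp (inj true) (injQ i) | inr j => pshcomp (inj false) (injR j) end).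
exists (fun i => match i return pshhom P (S i) with
  inl i => pshcomp (prjQ i) (prj true) | inr j => pshcomp (prjR j) (prj false) end).
split=> [[i|i] x v /=|[i|i] [j|j] x v ij /=|x v].
- by have /= -> := prjK true x (injQ i x v); apply: prjKQ.
- by have /= -> := prjK false x (injR i x v); apply: prjKR.
- by have /= -> := prjK true x (injQ j x v); apply: prj0Q.
- by rewrite (prj0 true false) // linear0.
- by rewrite (prj0 false true) // linear0.
- by have /= -> := prjK false x (injR j x v); apply: prj0R.
rewrite big_sumType /= -[RHS]sumK big_bool; congr (_ + _).
  by rewrite -[in RHS](sumKQ x (prj true x v)) linear_sum.
by rewrite -[in RHS](sumKR x (prj false x v)) linear_sum.
Qed.

Lemma finitely_projective_projective P : finitely_projective P -> projective P.
Proof.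
by move=> [n [Q [Qok sumQ]]]; apply: direct_sum_projective sumQ _ => i; case: (Qok i).
Qed.

Definition in_sub X (A : subpsh X) (t : {x : C & X x}) := A (projT1 t) (projT2 t).

(** Generation is phrased through subpresheaves rather than linear
    combinations: it then transfers along epimorphisms by taking inverse
    images. *)
Definition gen_by X (s : seq {x : C & X x}) :=
  forall A : subpsh X, List.Forall (in_sub A) s -> forall x v, A x v.

Lemma gen_by_surj X Y (f : pshhom X Y) s : pshsurj f -> gen_by s ->
  gen_by [seq existT (fun x => pob Y x) (projT1 t) (f (projT1 t) (projT2 t))
            | t <- s].
Proof.
move=> fS sX A /List.Forall_map As x w; have [v <-] := fS x w.
by apply: (sX (preim_subpsh f A)).
Qed.

Lemma gen_by_sum (I : finType) (Q : I -> psh k C) X : direct_sum Q X ->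
  (forall i, exists s, @gen_by (Q i) s) -> exists s, @gen_by X s.
Proof.
move=> [inj [prj [_ _ sumK]]] genQ.
have [s sP] : exists s, forall A : subpsh X, List.Forall (in_sub A) s ->
    forall i, i \in enum I -> forall x v, A x (inj i x v).
  elim: (enum I) => [|i r [s IHs]]; first by exists [::].
  have [t tP] := genQ i.
  exists ([seq existT (fun x => pob X x) (projT1 u)
                      (inj i (projT1 u) (projT2 u)) | u <- t] ++ s).
  move=> A /List.Forall_app[/List.Forall_map At As] j.
  rewrite inE => /orP[/eqP-> x v|/(IHs A As)//].
  by apply: (tP (preim_subpsh (inj i) A)).
exists s => A As x v; rewrite -[v]sumK; apply: (subspace_sum _ (sub_lin A x)) => i _.
by apply: sP => //; rewrite mem_enum.
Qed.

End Presheaves.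

(** * Surjections of finite groups and representable presheaves *)

Section GroupMorphisms.
Local Open Scope group_scope.

Lemma gmor_card (G H : finGroupType) (A : gmor G H) : (#|H| <= #|G|)%N.
Proof.
have [f [sf _ _]] := gmor_rep A.
have /andP[_ /eqP fS] := sf.
by rewrite -[#|H|]cardsT -fS -[#|G|]cardsT leq_imset_card.
Qed.

(** A surjection between groups of the same order is injective, so that A has
    the same kernel as the identity; a morphism of G factors through A as soon
    as A has the same kernel. *)
Lemma gmor_linv (G H : finGroupType) (A : gmor G H) : (#|G| <= #|H|)%N ->
  exists B : gmor H G, gcomp B A = gid G.
Proof.
move=> leGH.
suff /gker_fact[B ->] : gker A = gker (gid G) by exists B.
have [f [sf _ ->]] := gmor_rep A.
have [g [/surj_morphP[gM _] /setP gE ->]] := gmor_rep (gid G).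
have g_inj : injective g.
  have : g \in conj_class g.
    apply/imsetP; exists 1; rewrite ?inE //.
    by apply/ffunP => x; rewrite ffunE conjg1.
  rewrite -gE => /imsetP[h _ ->] x y; rewrite !ffunE; exact: conjg_inj.
have [fM _] := surj_morphP _ sf.
have f_inj : injective f.
  have /andP[_ /eqP fS] := sf.
  have /imset_injP f_inj : #|f @: [set: G]| == #|[set: G]|.
    by rewrite eqn_leq leq_imset_card fS !cardsT.
  by move=> x y; apply: f_inj; rewrite inE.
have one (K : finGroupType) (u : {ffun G -> K}) :
    {morph u : x y / x * y} -> u 1 = 1.
  by move=> uM; apply: (mulgI (u 1)); rewrite -uM !mulg1.
apply/setP => x; rewrite !inE.
rewrite -[in LHS](one _ _ fM) -[in RHS](one _ _ gM).
by rewrite (inj_eq f_inj) (inj_eq g_inj).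
Qed.

(** A left inverse has a left inverse too, which must be the morphism
    itself. *)
Lemma gmor_inv (G H : finGroupType) (A : gmor G H) : (#|G| <= #|H|)%N ->
  exists B : gmor H G, gcomp B A = gid G /\ gcomp A B = gid H.
Proof.
move=> leGH; have [B BA] := gmor_linv A leGH.
have [E EB] := gmor_linv B (gmor_card A).
exists B; split=> //; suff <- : E = A by [].
by rewrite -[E]gcompidr -BA gcompA EB gcompidl.
Qed.

(** The order of G and its multiplication table along the enumeration of G,
    coded in a finite set that only depends on the bound N; this bounds the
    number of isomorphism classes of groups of order at most N. *)
Definition mul_table (N : nat) (G : finGroupType) :
    'I_N.+1 * {ffun 'I_N * 'I_N -> 'I_N.+1} :=
  (inord #|G|, [ffun p : 'I_N * 'I_N =>
     inord (index (nth 1 (enum G) p.1 * nth 1 (enum G) p.2) (enum G))]).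

Lemma mul_table_gmor (N : nat) (G H : finGroupType) :
  (#|G| <= N)%N -> (#|H| <= N)%N -> mul_table N G = mul_table N H ->
  #|G| = #|H| /\ inhabited (gmor G H).
Proof.
move=> leG leH [/(congr1 (@nat_of_ord _))]; rewrite !inordK // => eGH /ffunP tGH.
split=> //.
have ltG (x : G) : (index x (enum G) < #|G|)%N.
  by rewrite cardE index_mem mem_enum.
have ltH (x : H) : (index x (enum H) < #|H|)%N.
  by rewrite cardE index_mem mem_enum.
have nG (x : G) : nth 1 (enum G) (index x (enum G)) = x.
  by rewrite nth_index ?mem_enum.
have nH (x : H) : nth 1 (enum H) (index x (enum H)) = x.
  by rewrite nth_index ?mem_enum.
pose f := [ffun x : G => nth 1 (enum H) (index x (enum G))].
have sf : surj_morph f.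
  apply/surj_morphP; split=> [x y|y].
    rewrite !ffunE.
    have := tGH (Ordinal (leq_trans (ltG x) leG), Ordinal (leq_trans (ltG y) leG)).
    rewrite !ffunE /= !nG => /(congr1 (@nat_of_ord _)).
    rewrite !inordK ?ltnS; last 2 first.
    - exact: leq_trans (ltnW (ltH _)) leH.
    - exact: leq_trans (ltnW (ltG _)) leG.
    by move=> ->; rewrite nH.
  exists (nth 1 (enum G) (index y (enum H))).
  rewrite ffunE index_uniq ?enum_uniq ?nH //.
  by rewrite -cardE eGH.
have gf : is_gmor (conj_class f) by apply/existsP; exists f; rewrite sf eqxx.
by constructor; exists (conj_class f).
Qed.

End GroupMorphisms.

Lemma finite_representatives (O : Type) (D : O -> Prop) (E : finType) (c : O -> E) :
  exists L : seq O, List.Forall D L /\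
    forall x, D x -> exists y, List.In y L /\ c y = c x.
Proof.
suff [L [LD LP]] : exists L : seq O, List.Forall D L /\
    forall x, D x -> c x \in enum E -> exists y, List.In y L /\ c y = c x.
  by exists L; split=> // x Dx; apply: LP; rewrite ?mem_enum.
elim: (enum E) => [|e r [L [LD LP]]]; first by exists [::]; split.
have [[y [Dy cy]]|ny] := pselect (exists y, D y /\ c y = e).
  exists (y :: L); split; first by constructor.
  move=> x Dx; rewrite inE => /orP[/eqP cx|/(LP x Dx)[z [zL cz]]].
    by exists y; split; [left|rewrite cx].
  by exists z; split=> //; right.
exists L; split=> // x Dx; rewrite inE => /orP[/eqP cx|/(LP x Dx)//].
by case: ny; exists x.
Qed.

Section Representables.
Local Open Scope ring_scope.
Variables (k : fieldType) (U : fingrp_cat -> Prop).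
Notation C := (fullsub U).
Notation card x := #|(sval x : finGroupType)|.

Lemma hom_inv (x y : C) (f : hom x y) : (card x <= card y)%N ->
  exists g : hom y x, hcomp g f = idm x /\ hcomp f g = idm y.
Proof. exact: gmor_inv. Qed.

Lemma finite_skeleton (N : nat) : exists L : seq C,
  forall x : C, (card x <= N)%N -> exists y, List.In y L /\ isomorphic x y.
Proof.
have [L [LD LP]] := finite_representatives (fun x : C => card x <= N)%N
  (fun x : C => mul_table N (sval x)).
exists L => x lx; have [y [yL cy]] := LP x lx; exists y; split=> //.
have ly : (card y <= N)%N by move/List.Forall_forall: LD; apply.
have [e [f]] := mul_table_gmor lx ly (esym cy).
by have [g gP] := @gmor_inv _ _ f (eq_leq e); exists f, g.
Qed.

Section Rep.
Variable G : C.

Definition rep_map (x y : C) (f : hom x y) :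
    {linear {ffun gmor (sval y) (sval G) -> k^o} ->
            {ffun gmor (sval x) (sval G) -> k^o}} :=
  lin_ext (fun a : gmor (sval y) (sval G) => basis_fun k (gcomp a f)).

Lemma rep_map_id x u : rep_map (idm x) u = u.
Proof.
move: u; apply: (@lin_ext_unique _ _ _ (rep_map (idm x)) idfun) => a.
by rewrite /= lin_ext_delta gcompidr.
Qed.

Lemma rep_map_comp x y z (g : hom y z) (f : hom x y) u :
  rep_map (hcomp g f) u = rep_map f (rep_map g u).
Proof.
move: u.
apply: (@lin_ext_unique _ _ _ (rep_map (hcomp g f)) (rep_map f \o rep_map g)).
move=> a.
by rewrite /= !lin_ext_delta gcompA.
Qed.

Definition rep : psh k C :=
  @Psh k C (fun x => {ffun gmor (sval x) (sval G) -> k^o} : lmodType k)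
    rep_map rep_map_id rep_map_comp.

Definition rep_unit : rep G := basis_fun k (gid (sval G)).

Lemma rep_map_unit x (a : hom x G) :
  pmap rep a rep_unit = basis_fun k (a : gmor _ _).
Proof. by rewrite /= /rep_unit lin_ext_delta gcompidl. Qed.

Section Yoneda.
Variables (Y : psh k C) (y : Y G).

Definition yoneda_cpt (x : C) : {linear rep x -> Y x} :=
  lin_ext (fun a : gmor (sval x) (sval G) => pmap Y (a : hom x G) y).

Lemma yoneda_natE x x' (f : hom x x') u :
  yoneda_cpt x (pmap rep f u) = pmap Y f (yoneda_cpt x' u).
Proof.
move: u; apply: (@lin_ext_unique _ _ _ (yoneda_cpt x \o rep_map f)
                                       (pmap Y f \o yoneda_cpt x')) => a.
by rewrite /= !lin_ext_delta -pmap_comp.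
Qed.

Definition yoneda : pshhom rep Y := PshHom yoneda_natE.

Lemma yoneda_unit : yoneda G rep_unit = y.
Proof. by rewrite /= /rep_unit lin_ext_delta (pmap_id (x := G)). Qed.

End Yoneda.

(** The Yoneda lemma: rep is generated by the identity of G. *)
Lemma rep_ext (Y : psh k C) (f g : pshhom rep Y) :
  f G rep_unit = g G rep_unit -> nat_eq f g.
Proof.
move=> fg x; apply: lin_ext_unique => a.
by have := rep_map_unit a => <-; rewrite !natE fg.
Qed.

Lemma rep_projective : projective rep.
Proof.
move=> Y Z e f /epi_pshsurj/(_ G (f G rep_unit))[y ey].
by exists (yoneda y); apply: rep_ext; rewrite -ey [LHS]/= -[in RHS](yoneda_unit y).
Qed.

Lemma rep_gen : gen_by [:: existT (fun x => pob rep x) G rep_unit].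
Proof.
move=> A /List.Forall_cons_iff[A1 _] x u; rewrite (basis_fun_sum u).
apply: (subspace_sum _ (sub_lin A x)) => a _; apply: (subspaceZ _ (sub_lin A x)).
by have := rep_map_unit a => <-; apply: sub_pull.
Qed.

(** If Q = Y + Z is a nontrivial decomposition of a retract of rep, then Y(G)
    and Z(G) are nonzero, because a map out of rep that vanishes on the
    identity of G is zero. So the ranks at G of the idempotents that cut out Y
    and Z are smaller than the one for Q, and splitting off summands comes to
    an end. *)
Lemma rep_retract_finitely_projective (d : nat) (Q : psh k C)
    (i : pshhom Q rep) (p : pshhom rep Q) :
  nat_eq (pshcomp p i) (pshid Q) -> (\dim (limg (linfun (i G \o p G))) < d)%N ->
  finitely_projective Q.
Proof.
elim: d Q i p => [|d IHd] Q i p pi //; rewrite ltnS => le_d.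
have projQ := projective_retract rep_projective pi.
have [Q0|nQ0] := pselect (is_zero Q); first exact: finitely_projective_zero.
have [indQ|] := pselect (indecomposable Q); first exact: finitely_projective1.
move=> /not_andP[//|/existsNP[Y /existsNP[Z]]].
move=> /not_implyP[[inj [prj [prjK prj0 sumK]]] /not_orP[nY nZ]].
have proper b : ~ is_zero (if ~~ b then Y else Z) ->
    (\dim (limg (linfun (pshcomp i (inj b) G \o pshcomp (prj b) p G))) < d)%N.
  move=> nb; apply: leq_trans le_d.
  have pE x v : p x (i x v) = v by apply: pi.
  set L := limg _; set M := limg (linfun (i G \o p G)).
  have sLM : (L <= M)%VS.
    apply/subvP => _ /memv_imgP[u _ ->]; rewrite lfunE /=.
    apply/memv_imgP; exists (i G (inj b G (prj b G (p G u)))); first exact: memvf.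
    by rewrite lfunE /= pE.
  rewrite (ltn_leqif (dimv_leqif_sup sLM)).
  apply/negP => /subvP sML; apply: nb => x v.
  pose z := prj (~~ b) G (p G rep_unit).
  have z0 : z = 0.
    have /sML/memv_imgP[u _] : i G (inj (~~ b) G z) \in M.
      apply/memv_imgP; exists (i G (inj (~~ b) G z)); first exact: memvf.
      by rewrite lfunE /= pE.
    rewrite lfunE /= => /(congr1 (fun w => prj (~~ b) G (p G w))).
    rewrite !pE (prj0 (~~ b) b); last by case: (b).
    by have /= -> := prjK (~~ b) G z.
  have hom0 : nat_eq (pshcomp (prj (~~ b)) p)
                     (yoneda (0 : (if ~~ b then Y else Z) G)).
    by apply: rep_ext; rewrite yoneda_unit.
  have := hom0 x (i x (inj (~~ b) x v)).
  rewrite /= pE; have /= -> := prjK (~~ b) x v; move=> ->.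
  by rewrite /lin_ext big1 // => a _; rewrite linear0 scaler0.
have retract b : nat_eq (pshcomp (pshcomp (prj b) p) (pshcomp i (inj b))) (pshid _).
  by move=> x v /=; have /= -> := pi x (inj b x v); apply: prjK.
apply: (@finitely_projective_sum _ _ Y Z); first by exists inj, prj.
  exact: (IHd _ _ _ (retract true) (proper true nZ)).
exact: (IHd _ _ _ (retract false) (proper false nY)).
Qed.

Lemma rep_finitely_projective : finitely_projective rep.
Proof.
apply: (@rep_retract_finitely_projective _ rep (pshid rep) (pshid rep)) => //.
Qed.

Lemma rep_finite_type : finite_type rep.
Proof. by move=> x; apply: finite_dim_vectType. Qed.

End Rep.

End Representables.

(** * Indecomposable projectives *)

Section Indecomposable.
Local Open Scope ring_scope.
Variables (k : fieldType) (U : fingrp_cat -> Prop).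
Hypothesis k_char0 : [pchar k] =i pred0.
Notation C := (fullsub U).
Notation card x := #|(sval x : finGroupType)|.

Section TopDegree.
Variables (P : psh k C) (G : C).
Hypothesis P_min : forall (x : C) (v : P x), (card x < card G)%N -> v = 0.

Notation O := (gmor (sval G) (sval G)).

Definition out_inv (a : O) : O := sval (cid (@hom_inv U G G a (leqnn _))).

Lemma out_invl a : gcomp (out_inv a) a = gid (sval G).
Proof. by rewrite /out_inv; case: cid => b []. Qed.

Lemma out_invr a : gcomp a (out_inv a) = gid (sval G).
Proof. by rewrite /out_inv; case: cid => b []. Qed.

Lemma out_inv_uniq a b : gcomp a b = gid (sval G) -> out_inv a = b.
Proof. by move=> ab; rewrite -[b]gcompidl -(out_invl a) -gcompA ab gcompidr. Qed.

Lemma out_invK : involutive out_inv.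
Proof. by move=> a; apply/out_inv_uniq/out_invl. Qed.

(** Coefficient of the identity; by the Yoneda lemma it gives a map from rep G
    to the functions on hom(G, -), which at G is the isomorphism sending a
    basis element a to the indicator of the inverse of a. *)
Definition coind_unit : coind G (k^o : lmodType k) G :=
  fun f => ((f : O) == gid (sval G))%:R.

Lemma yoneda_coind_unitE (u : rep k G G) (f : O) :
  yoneda coind_unit G u (f : hom G G) = (u : {ffun O -> k^o}) (out_inv f).
Proof.
rewrite /= /lin_ext fct_sumE (bigD1 (out_inv f)) //= big1 => [|a af].
  rewrite addr0.
  transitivity ((u : {ffun O -> k^o}) (out_inv f) *
                (gcomp (out_inv f) f == gid (sval G))%:R) => //.
  by rewrite out_invl eqxx mulr1.
transitivity ((u : {ffun O -> k^o}) a * (gcomp a f == gid (sval G))%:R) => //.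
rewrite (_ : (_ == _) = false) ?mulr0 //.
by apply: contraNF af => /eqP/out_inv_uniq <-; rewrite out_invK.
Qed.

(** At an object smaller than G the presheaf P vanishes; at one of the same
    order with a morphism from G, hence isomorphic to G, the map from rep G is
    onto; at all others there are only zero functions. *)
Lemma coind_hom_in_image (l : {linear P G -> k^o}) x (v : P x) :
  exists u, yoneda coind_unit x u = coind_hom l x v.
Proof.
have [[f _]|nf] := pselect (exists f : hom G x, True); last first.
  exists 0; apply/funext => f; by case: nf; exists f.
have [ltxG|leGx] := ltnP (card x) (card G).
  by exists 0; rewrite (P_min v ltxG) !linear0.
have [g [gf fg]] := hom_inv f leGx.
pose u : rep k G G := [ffun a : O => l (pmap P (out_inv a : hom G G) (pmap P f v))].
exists (pmap (rep k G) g u); rewrite natE.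
suff -> : yoneda coind_unit G u = coind_hom l G (pmap P f v).
  by rewrite -natE -pmap_comp fg pmap_id.
by apply/funext => a; rewrite yoneda_coind_unitE ffunE out_invK.
Qed.

(** A linear form l on P(G) gives a map from P to the coinduced presheaf,
    which lands in the image of rep G and so lifts to rep G as P is
    projective. Every equivariant map from P(G) to the group algebra of the
    outer automorphisms of G arises in this way: l is its coefficient at the
    identity. *)
Lemma top_degree_lift (l : {linear P G -> k^o}) : projective P ->
  exists L : pshhom P (rep k G), forall v (a : O),
    (L G v : {ffun O -> k^o}) a = l (pmap P (out_inv a : hom G G) v).
Proof.
move=> /projective_lift/(_ (coind_hom_in_image l))[L LP].
exists L => v a; rewrite -{1}[a]out_invK -yoneda_coind_unitE.
by have /(congr1 (fun u => u (out_inv a : hom G G))) := LP G v.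
Qed.

(** Maschke: let s be a linear generalized inverse of the map u |-> u . v from
    the group algebra to P(G). Averaging s over the outer automorphisms of G,
    whose number is invertible in characteristic zero, makes it equivariant
    while it still splits the map above v. The form lf below is the
    coefficient at the identity of this average, and top_degree_lift extends
    the average to P. *)
Lemma top_degree_split (v : P G) : projective P ->
  exists L : pshhom P (rep k G), yoneda v G (L G v) = v.
Proof.
move=> projP; have [s sP] := generalized_inverse (yoneda v G).
have yd (a : O) : yoneda v G (basis_fun k a) = pmap P (a : hom G G) v.
  by rewrite /= lin_ext_delta.
pose r : k := (#|{: O}|%:R)^-1.
have O0 : #|{: O}|%:R != 0 :> k.
  rewrite (proj1 (pcharf0P k) k_char0) -lt0n.
  by apply/card_gt0P; exists (gid (sval G)).
pose lf u : k^o := \sum_(g : O) r * (s (pmap P (g : hom G G) u) : {ffun O -> k^o}) g.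
have lf_lin : linear lf.
  move=> a u w; rewrite /lf scaler_sumr -big_split; apply: eq_bigr => g _.
  rewrite !linearP !ffunE /= /GRing.scale /= mulrDr.
  by congr (_ + _); rewrite mulrCA.
have [L LP] := top_degree_lift (mklin lf_lin) projP.
exists L.
transitivity (\sum_(a : O) \sum_(g : O)
  (r * (s (pmap P (g : hom G G) (pmap P (out_inv a : hom G G) v)) : {ffun O -> k^o}) g)
   *: pmap P (a : hom G G) v).
  by rewrite /= /lin_ext; apply: eq_bigr => a _; rewrite LP -scaler_suml.
rewrite exchange_big /=.
(* Substitute a = g h^-1, so that the argument of s no longer involves g. *)
transitivity (\sum_(g : O) \sum_(h : O)
  (r * (s (pmap P (h : hom G G) v) : {ffun O -> k^o}) g)
   *: pmap P (out_inv h : hom G G) (pmap P (g : hom G G) v)).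
  apply: eq_bigr => g _.
  have hK : cancel (fun h : O => gcomp g (out_inv h))
                   (fun a : O => gcomp (out_inv a) g).
    move=> h /=; rewrite -[RHS]gcompidr -(out_invl g).
    rewrite (@out_inv_uniq _ (gcomp h (out_inv g))); first by rewrite -gcompA.
    by rewrite -gcompA (gcompA (out_inv h)) out_invl gcompidl out_invr.
  have hK' : cancel (fun a : O => gcomp (out_inv a) g)
                    (fun h : O => gcomp g (out_inv h)).
    move=> a /=; rewrite (@out_inv_uniq _ (gcomp (out_inv g) a)).
      by rewrite gcompA out_invr gcompidl.
    by rewrite -gcompA (gcompA g) out_invr gcompidl out_invl.
  rewrite (reindex (fun h : O => gcomp g (out_inv h))) /=; last first.
    by exists (fun a : O => gcomp (out_inv a) g) => a _.
  apply: eq_bigr => h _.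
  rewrite -!(@pmap_comp _ _ P G G G).
  congr (((r * (s (pmap P _ v) : {ffun O -> k^o}) g)) *: _).
  exact: hK.
rewrite exchange_big /=.
transitivity (\sum_(h : O) r *: v); last first.
  rewrite sumr_const -scaler_nat scalerA divff ?scale1r //.
apply: eq_bigr => h _.
have vE : pmap P (out_inv h : hom G G)
            (yoneda v G (s (pmap P (h : hom G G) v))) = v.
  by rewrite -yd sP yd -(@pmap_comp _ _ P G G G) /= out_invr (@pmap_id _ _ P G).
rewrite -[in RHS]vE /= /lin_ext linear_sum scaler_sumr.
by apply: eq_bigr => g _; rewrite linearZ scalerA.
Qed.

End TopDegree.

(** Take G of minimal order with P(G) nonzero and v in P(G) nonzero. With L as
    in top_degree_split, the composite t of L and yoneda v is an idempotent of
    P with t v = v; P being indecomposable, t is the identity and yoneda v is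
    onto. *)
Lemma indecomposable_projective_yoneda_surj (P : psh k C) :
  indecomposable P -> projective P -> exists (G : C) (v : P G), pshsurj (yoneda v).
Proof.
move=> indP projP; have [nzP _] := indP.
have /existsNP[x /existsNP[w w0]] := nzP.
have ex : exists n, `[< exists (x : C) (v : P x), card x = n /\ v <> 0 >].
  by exists (card x); apply/asboolP; exists x, w.
have [n /asboolP[G [v [cG v0]]] n_min] := ex_minnP ex.
have P_min (y : C) (u : P y) : (card y < card G)%N -> u = 0.
  move=> lty; apply: contrapT => u0; move: lty; rewrite cG ltnNge => /negP; apply.
  by apply: n_min; apply/asboolP; exists y, u.
have [L Lv] := top_degree_split P_min v projP.
exists G, v; pose t := pshcomp (yoneda v) L.
have tv : t G v = v by [].
(* By Yoneda, t fixes the image of yoneda v, which contains that of t. *)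
have t_yoneda : nat_eq (pshcomp t (yoneda v)) (yoneda v).
  apply: rep_ext; transitivity (t G (yoneda v G (rep_unit k G))) => //.
  by rewrite yoneda_unit.
have tt : nat_eq (pshcomp t t) t by move=> y u; apply: (t_yoneda y (L y u)).
have [t0|t1] := indecomposable_idem indP tt; first by case: v0; rewrite -tv t0.
by move=> y u; exists (L y u); apply: t1.
Qed.

Lemma finitely_projective_gen (P : psh k C) :
  finitely_projective P -> exists s, @gen_by _ _ P s.
Proof.
move=> [n [Q [Qok sumQ]]]; apply: (gen_by_sum sumQ) => i.
have [indQ projQ] := Qok i.
have [G [v vS]] := indecomposable_projective_yoneda_surj indQ projQ.
by eexists; apply: (gen_by_surj vS); apply: rep_gen.
Qed.

(** The direct sum of the representables at the degrees of the elements of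
    s. *)
Lemma finite_free_cover (X : psh k C) (s : seq {x : C & X x}) :
  exists (P : psh k C) (e : pshhom P X),
    [/\ finitely_projective P, finite_type P
      & List.Forall (in_sub (image_subpsh e)) s].
Proof.
elim: s => [|[G v] s [P [e [fpP ftP eP]]]].
  exists (psh_zero k C), (pshsum (fun i : void => match i with end)); split=> //.
    by apply/finitely_projective_zero/psh_zeroP.
  by move=> x; apply: finite_dim_vectType.
pose e' := pshsum (fun b : bool =>
  if b then pshcomp (yoneda v) (psh_fst (rep k G) P)
  else pshcomp e (psh_snd (rep k G) P)).
have e'E x u w : e' x (u, w) = yoneda v x u + e x w by rewrite /= big_bool.
exists (psh_prod (rep k G) P), e'; split.
- apply: finitely_projective_sum (psh_prod_sum _ _) _ fpP.
  exact: rep_finitely_projective.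
- by move=> x; apply: finite_dim_prod (rep_finite_type _ _ _) (ftP x).
- constructor; first by exists (rep_unit k G, 0); rewrite e'E linear0 addr0 yoneda_unit.
  apply: List.Forall_impl eP => -[x w] [u eu].
  by exists (0, u); rewrite e'E linear0 add0r.
Qed.

Lemma gen_by_cover (X : psh k C) s : @gen_by _ _ X s ->
  exists (P : psh k C) (e : pshhom P X),
    [/\ finitely_projective P, finite_type P & pshsurj e].
Proof.
move=> sX; have [P [e [fpP ftP eP]]] := finite_free_cover s.
by exists P, e; split=> //; apply: (sX (image_subpsh e)).
Qed.

Lemma finitely_generatedP (X : psh k C) :
  finitely_generated X <-> exists s, @gen_by _ _ X s.
Proof.
split=> [[P [e [/finitely_projective_gen[s sP] /epi_pshsurj eS]]]|[s /gen_by_cover]].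
  by eexists; apply: gen_by_surj eS sP.
by move=> [P [e [fpP _ eS]]]; exists P, e; split=> //; apply: pshsurj_epi.
Qed.

Lemma gen_by_finite_type (X : psh k C) s : @gen_by _ _ X s -> finite_type X.
Proof.
move=> /gen_by_cover[P [e [_ ftP eS]]] x.
by apply: (finite_dim_quo (eS x)).
Qed.

End Indecomposable.

(** * Truncation and generation in bounded degree *)

Section Degrees.
Local Open Scope ring_scope.
Variables (k : fieldType) (U : fingrp_cat -> Prop).
Notation C := (fullsub U).
Notation card x := #|(sval x : finGroupType)|.

Definition gen_le (n : nat) (X : psh k C) := forall A : subpsh X,
  (forall c : C, (card c <= n)%N -> forall y, A c y) -> forall x v, A x v.

Lemma gen_le_mono n m X : (n <= m)%N -> gen_le n X -> gen_le m X.
Proof. by move=> nm nX A Am; apply: nX => c cn; apply: Am; apply: leq_trans nm. Qed.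

Lemma gen_by_le X s : @gen_by k C X s -> exists N, gen_le N X.
Proof.
move=> sX; pose N := foldr maxn 0%N [seq card (projT1 t) | t <- s].
have sN : List.Forall (fun t : {x : C & X x} => (card (projT1 t) <= N)%N) s.
  rewrite /N; elim: (s) => [|t r IHr] /=; constructor; first exact: leq_maxl.
  by apply: List.Forall_impl IHr => u ur; apply: leq_trans ur (leq_maxr _ _).
by exists N => A AN; apply: sX; apply: List.Forall_impl sN => t tN; apply: AN.
Qed.

(** There are finitely many isomorphism classes of groups of order at most N,
    and the value of X at each of them is spanned by a finite list. *)
Lemma gen_le_by N X : finite_type X -> gen_le N X -> exists s, @gen_by k C X s.
Proof.
move=> ftX nX; have [L LP] := finite_skeleton U N.
have [s sP] : exists s : seq {x : C & X x}, forall A : subpsh X,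
    List.Forall (in_sub A) s -> forall y, List.In y L -> forall v, A y v.
  elim: L {LP} => [|y L [s IHs]]; first by exists [::].
  have [t tP] := finite_dim_span (ftX y).
  exists ([seq existT (fun x => pob X x) y v | v <- t] ++ s).
  move=> A /List.Forall_app[/List.Forall_map At As] z [<-|zL]; last exact: IHs.
  exact: tP (sub_lin A y) At.
exists s => A As; apply: nX => c cN v.
have [y [yL [f [g [gf fg]]]]] := LP c cN.
rewrite -[v]pmap_id -gf pmap_comp.
by apply: sub_pull; apply: sP.
Qed.

Variable n : nat.

Notation S := (group_solution_set (@order_le U n)).
Notation J := (incl_le U n).
Notation tau_in X := (@lan_in k _ _ J S (restr J X) _ _).

Lemma lan_sub (Y : psh k (fullsub (@order_le U n))) (d : C)
    (B : lan S Y d -> Prop) :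
  subspace B -> (forall c (a : hom d (J c)) y, B (lan_in S a y)) -> forall q, B q.
Proof.
move=> sB B_in q; rewrite -[q]lan_classK lan_class_sum.
by apply: subspace_sum.
Qed.

Lemma counit_in (X : psh k C) (d : C) c (a : hom d (J c)) (y : X (J c)) :
  tau_counit n X d (tau_in X a y) = pmap X a y.
Proof. exact: lan_ind_in. Qed.

(** At x, the image of the counit consists of the sums of elements X(a) y for
    a : x -> c with c of order at most n. *)
Lemma counit_surj X : pshsurj (tau_counit n X) <-> gen_le n X.
Proof.
split=> [tS A An x v|nX x v]; last first.
  apply: (nX (image_subpsh (tau_counit n X))) => c cn y.
  exists (tau_in X (idm c : hom c (J (exist _ c cn))) y).
  by rewrite counit_in pmap_id.
have [q <-] := tS x v; move: q; apply: lan_sub.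
  exact: (subspace_preim (tau_counit n X x) (sub_lin A x)).
move=> c a y; rewrite counit_in; apply: sub_pull; apply: An.
exact: (svalP c).
Qed.

Lemma tau_ext (X : psh k C) (d : C) (V : lmodType k)
    (f g : {linear tau n X d -> V}) :
  (forall c (a : hom d (J c)) y, f (tau_in X a y) = g (tau_in X a y)) -> f =1 g.
Proof. exact: lan_ext. Qed.

Definition tau_map (X Y : psh k C) (f : pshhom X Y) : pshhom (tau n X) (tau n Y) :=
  lan_transpose S (pshcomp (lan_unit S (restr J Y)) (restr_hom J f)).

Lemma tau_map_in X Y (f : pshhom X Y) (d : C) c (a : hom d (J c)) (y : X (J c)) :
  tau_map f d (tau_in X a y) = tau_in Y a (f (J c) y).
Proof.
rewrite [LHS]lan_ind_in /=.
by rewrite lan_map_in compidl.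
Qed.

Lemma tau_counit_natE X Y (f : pshhom X Y) d q :
  tau_counit n Y d (tau_map f d q) = f d (tau_counit n X d q).
Proof.
move: q.
apply: (tau_ext (f := tau_counit n Y d \o tau_map f d)
                (g := f d \o tau_counit n X d)).
move=> c a y.
change (tau_counit n Y d (tau_map f d (tau_in X a y)) =
  f d (tau_counit n X d (tau_in X a y))).
rewrite tau_map_in !counit_in.
by rewrite natE.
Qed.

Lemma tau_map_surj X Y (f : pshhom X Y) : pshsurj f -> pshsurj (tau_map f).
Proof.
move=> fS d; apply: lan_sub; first exact: subspace_image.
by move=> c a y; have [x <-] := fS _ y; exists (tau_in X a x); apply: tau_map_in.
Qed.

(** At a group c of order at most n the counit is an isomorphism, the Kan
    extension along a full inclusion being unchanged there. *)
Lemma tau_in_le (X : psh k C) (c : C) (cn : order_le n c) (q : tau n X c) :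
  q = tau_in X (idm c : hom c (J (exist _ c cn))) (tau_counit n X c q).
Proof.
pose u := (lan_unit S (restr J X) (exist _ c cn)).
move: q; apply: (tau_ext (f := idfun) (g := u \o tau_counit n X c)).
move=> c' a y.
change (tau_in X a y = u (tau_counit n X c (tau_in X a y))).
rewrite counit_in.
have := @lan_inE _ _ _ J S (restr J X) c (exist _ c cn) c' a (idm c) y.
rewrite [X in lan_in _ X](_ : _ = a) //; exact: gcompidr.
Qed.

(** A section s of the counit, which exists as P is projective, is a two-sided
    inverse: s followed by the counit is a map out of a Kan extension, so it
    is enough to compare it with the identity at the groups of order at most
    n, where tau_in_le applies. *)
Lemma projective_counit_inj (P : psh k C) :
  projective P -> gen_le n P -> pshinj (tau_counit n P).
Proof.
move=> projP /counit_surj/pshsurj_epi e_epi.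
have [s sP] := projP _ _ (tau_counit n P) (pshid P) e_epi.
suff sE x q : s x (tau_counit n P x q) = q.
  by move=> x q q0; rewrite -[q]sE q0 linear0.
move: q; apply: (tau_ext (f := s x \o tau_counit n P x) (g := idfun)).
move=> c a y.
change (s x (tau_counit n P x (tau_in P a y)) = tau_in P a y).
rewrite counit_in natE.
case: c a y => c cn a y.
rewrite (tau_in_le cn (s c y)); have /= -> := sP c y.
by rewrite /= lan_map_in compidl.
Qed.

(** This is the four lemma for the counits of P1 -> P0 -> X. An element q of
    tau X killed by the counit lifts to p in tau P0, whose image in P0 comes
    from P1, hence from tau P1; by injectivity for P0 this lifts p itself to
    tau P1, and then q = 0. *)
Lemma counit_inj_quotient (P1 P0 X : psh k C) (d : pshhom P1 P0) (e : pshhom P0 X) :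
  exact_at d e -> pshsurj e -> gen_le n P1 -> pshinj (tau_counit n P0) ->
  pshinj (tau_counit n X).
Proof.
move=> ex eS /counit_surj t1S t0I x q tq0.
have [p eq] := tau_map_surj eS q.
have [r dr] : exists r, d x r = tau_counit n P0 x p.
  by apply/ex; rewrite -tau_counit_natE eq.
have [r' tr] := t1S x r.
have pE : p = tau_map d x r'.
  apply/eqP; rewrite -subr_eq0; apply/eqP/t0I.
  by rewrite linearB tau_counit_natE tr dr subrr.
rewrite -eq pE.
move: r' {tr pE}.
apply: (tau_ext (f := tau_map e x \o tau_map d x) (g := \0%R)).
move=> c a y.
change (tau_map e x (tau_map d x (tau_in P1 a y)) = 0).
rewrite !tau_map_in.
have -> : e (J c) (d (J c) y) = 0 by apply/ex; exists y.
by rewrite linear0.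
Qed.

(** Let K be the kernel of e and A a subpresheaf of K containing K(c) for all
    c of order at most n, and let p be a linear map on P(x) with kernel A(x).
    The maps y |-> p(P(a) u), with e u = y, are well defined because K(c) lies
    in A, and form a cocone on X over the groups of order at most n. The
    induced map on tau X is compatible with p, so that p kills w in K(x), as w
    lifts to an element of tau P whose image in tau X vanishes, the counit of
    X being injective. *)
Lemma ker_gen_le (P X : psh k C) (e : pshhom P X) :
  pshsurj e -> gen_le n P -> pshinj (tau_counit n X) ->
  gen_le n (psh_of_sub (ker_subpsh e)).
Proof.
move=> eS /counit_surj tPS tXI A An x w.
set K := psh_of_sub (ker_subpsh e) in A An w *.
pose i := sub_incl (ker_subpsh e).
pose B (v : P x) := exists u : K x, A x u /\ i x u = v.
have sB : subspace B.
  have [A0 As] := sub_lin A x.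
  split; first by exists 0; rewrite linear0.
  move=> a _ _ [u [Au <-]] [v [Av <-]]; exists (a *: u + v).
  by rewrite linearP; split=> //; apply: As.
have [p [pB Bp]] := subspace_projector sB.
have p_ker (c : C) (cn : order_le n c) (a : hom x c) (v : P c) :
    e c v = 0 -> p (pmap P a v) = 0.
  move=> /(sub_incl_ex (A := ker_subpsh e))[u <-]; apply: pB.
  by exists (pmap K a u); split; [apply: sub_pull; apply: An|].
pose R (c : fullsub (@order_le U n)) (a : hom x (J c)) (y : X (J c)) (v : P x) :=
  exists u, e (J c) u = y /\ v = p (pmap P a u).
have Rex c a : exists f : {linear X (J c) -> P x}, forall y, @R c a y (f y).
  apply: linear_of_rel.
  - by move=> y; have [u eu] := eS _ y; exists (p (pmap P a u)), u.
  - move=> y _ _ [u [eu ->]] [v [ev ->]]; apply/eqP; rewrite -subr_eq0 -!linearB.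
    by apply/eqP/p_ker; [apply: (svalP c)|rewrite linearB eu ev subrr].
  - move=> b y _ z _ [u [eu ->]] [v [ev ->]]; exists (b *: u + v).
    by rewrite !linearP eu ev.
(* phi_at c a sends e u to p(P(a) u). *)
pose phi_at c a := sval (cid (@Rex c a)).
have phiE c a u : phi_at c a (e (J c) u) = p (pmap P a u).
  rewrite /phi_at; case: cid => f fP /=; have [u' [eu ->]] := fP (e (J c) u).
  apply/eqP; rewrite -subr_eq0 -!linearB; apply/eqP/p_ker; first exact: (svalP c).
  by rewrite linearB eu subrr.
have phi_leg c c' (b : hom c c') (a : hom x (J c)) (y : X (J c')) :
    phi_at c' (hcomp (fmap J b) a) y = phi_at c a (pmap X (fmap J b) y).
  by have [u <-] := eS _ y; rewrite phiE -natE phiE pmap_comp.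
pose phi := @Cocone k _ _ J (restr J X) x (P x) phi_at phi_leg.
have phi_tau q : lan_ind phi (tau_map e x q) = p (tau_counit n P x q).
  move: q; apply: (tau_ext (f := lan_ind phi \o tau_map e x)
                           (g := p \o tau_counit n P x)).
  move=> c a y.
  change (lan_ind phi (tau_map e x (tau_in P a y)) =
    p (tau_counit n P x (tau_in P a y))).
  rewrite tau_map_in counit_in lan_ind_in.
  exact: phiE.
have [q tq] := tPS x (i x w).
have eq0 : tau_map e x q = 0.
  by apply: tXI; rewrite tau_counit_natE tq; apply: (sub_inclP w).
have pw : p (i x w) = 0 by rewrite -tq -phi_tau eq0 linear0.
have := Bp (i x w); rewrite pw subr0 => -[u [Au /sub_incl_inj <-]].
exact: Au.
Qed.

End Degrees.

(** * Finite generation and finite presentation *)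

Theorem proposition14p3 (k : fieldType) (k_char0 : [pchar k]%R =i pred0)
    (U : fingrp_cat -> Prop) (U_replete : replete U) (X : psh k (fullsub U)) :
  (finitely_generated X <->
     finite_type X /\
     exists N : nat, forall n : nat, N <= n -> epi (tau_counit n X)) /\
  (finitely_presented X <->
     finite_type X /\
     exists N : nat, forall n : nat, N <= n -> iso (tau_counit n X)).
Proof.
have fgE : finitely_generated X <-> finite_type X /\ exists N, gen_le N X.
  split=> [/(finitely_generatedP k_char0)[s sX]|[ftX [N NX]]].
    by split; [apply: gen_by_finite_type sX|apply: gen_by_le sX].
  by apply/(finitely_generatedP k_char0)/(gen_le_by ftX NX).
have epiE n : epi (tau_counit n X) <-> gen_le n X.
  by split=> [/epi_pshsurj/counit_surj|/counit_surj/pshsurj_epi].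
have fp_gen (P : psh k (fullsub U)) : finitely_projective P -> exists N, gen_le N P.
  by move=> /(finitely_projective_gen k_char0)[s /gen_by_le].
split.
  split=> [/fgE[ftX [N NX]]|[ftX [N NX]]].
    by split=> //; exists N => n Nn; apply/epiE; apply: gen_le_mono NX.
  by apply/fgE; split=> //; exists N; apply/epiE/NX.
split=> [[P1 [P0 [d [e [fp1 fp0 ex e_epi]]]]]|[ftX [N NX]]].
  have /fgE[ftX [N NX]] : finitely_generated X by exists P0, e.
  split=> //; have [[N1 P1N] [N0 P0N]] := (fp_gen _ fp1, fp_gen _ fp0).
  exists (maxn N (maxn N1 N0)) => n; rewrite !geq_max => /and3P[Nn N1n N0n].
  apply/iso_pshbij; split; last by apply/counit_surj/(gen_le_mono Nn NX).
  apply: (counit_inj_quotient ex (epi_pshsurj e_epi) (gen_le_mono N1n P1N)).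
  apply: projective_counit_inj (gen_le_mono N0n P0N).
  exact: finitely_projective_projective.
have gX : exists s, @gen_by _ _ X s.
  apply: (gen_le_by (N := N) ftX); apply/counit_surj.
  by have /iso_pshbij[] := NX N (leqnn N).
have [s /gen_by_cover[P0 [e [fp0 ft0 eS]]]] := gX.
have [N0 P0N] := fp_gen _ fp0.
(* The kernel of the cover P0 -> X is finitely generated, which gives P1. *)
pose K := psh_of_sub (ker_subpsh e).
have ftK : finite_type K.
  by move=> x; apply: (finite_dim_sub (@sub_incl_inj _ _ _ (ker_subpsh e) x) (ft0 x)).
have [t /gen_by_cover[P1 [d [fp1 _ dS]]]] : exists t, @gen_by _ _ K t.
  apply: (gen_le_by (N := maxn N N0) ftK).
  apply: ker_gen_le => //; first exact: gen_le_mono (leq_maxr _ _) P0N.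
  by have /iso_pshbij[] := NX _ (leq_maxl N N0).
exists P1, P0, (pshcomp (sub_incl (ker_subpsh e)) d), e.
split=> //; last exact: pshsurj_epi.
move=> x v; split=> [ev|[u <-]]; last exact: (sub_inclP (d x u)).
have [w <-] := sub_incl_ex (A := ker_subpsh e) ev.
by have [u <-] := dS x w; exists u.
Qed.
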